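(* Assume (G), (ND) and (LG) (see context), with constants $A,B>0$ from (LG), and put $$D=\frac{q}{p-1}\cdot\frac{B^2}{A(A+B)(2A+B)}.$$ For $n\in\mathbb Z$ let $s_1(k_n)\le s_2(k_n)\le\cdots$ be the slopes of $\mathrm{NP}(G_{k_n})$, listed with multiplicity. Then: (a) there is a constant $C>0$ such that for all sufficiently large $n$ and all $1\le i\le d(n)$, $$\bigl|s_i(k_n)-D\, i\bigr|\le C\log n;$$ (b) there is a constant $C>0$ such that for all sufficiently large $n$ and all $i$ with $d(n)<i\le d(n)+d^{\mathrm{new}}(n)$, $$\Bigl|s_i(k_n)-\frac{p}{(p-1)^2}\cdot\frac{B^2}{2A(A+B)}\cdot k_n\Bigr|\le C\log n;$$ (c) for every $\varepsilon>0$ there is a constant $C_\varepsilon>0$ such that for all sufficiently large $n$ and all $i>d(n)+d^{\mathrm{new}}(n)$, $$\bigl|s_i(k_n)-D\, i\bigr|\le C_\varepsilon\, i^{1/2+\varepsilon}.$$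
   Context: Fix a prime $p$. Let $\delta=p-1$ and $q=p$ if $p$ is odd, and $\delta=2$ and $q=4$ if $p=2$. Let $v_p$ be the $p$-adic valuation on $\mathbf C_p$ with $v_p(p)=1$. Fix an integer $k_0$ with $0\le k_0<\delta$ and functions $d,d^{\mathrm{new}}:\mathbb Z\to\mathbb Z$. Put $k_n=k_0+n\delta$ for $n\in\mathbb Z$ and $d_p=2d+d^{\mathrm{new}}$. Assume: (G) $d(n)\to\infty$ as $n\to+\infty$ and $d(n)+d^{\mathrm{new}}(n)\to-\infty$ as $n\to-\infty$; (ND) $d$, $d+d^{\mathrm{new}}$ and $d_p$ are non-decreasing functions; (LG) there are real numbers $A,B>0$ with $d(n)=An+O(1)$ and $d^{\mathrm{new}}(n)=Bn+O(1)$ as $n\to+\infty$. Weight space: $\mathscr W_{k_0}$ is the set of continuous characters $\kappa:\mathbb Z_p^\times\to\mathbf C_p^\times$ whose restriction to the torsion subgroup of $\mathbb Z_p^\times$ is $z\mapsto z^{k_0}$. Fix a topological generator $\gamma$ of $1+2p\mathbb Z_p$ and set $w_\kappa=\kappa(\gamma)-1$, except when $p=2$ and $k_0=1$, in which case $w_\kappa=\kappa(\gamma)\gamma^{-1}-1$. Each integer $k_n$ is regarded as the character $z\mapsto z^{k_n}$ in $\mathscr W_{k_0}$, with coordinate $w_{k_n}\in\mathbb Z_p$. Ghost series: for each $i\ge0$, $g_i(w)\in\mathbb Z_p[w]$ is the monic polynomial whose roots are exactly the $w_{k_n}$ with $d(n)<i<d(n)+d^{\mathrm{new}}(n)$, where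 $w_{k_n}$ has multiplicity $i-d(n)$ if $d(n)<i\le d(n)+\tfrac12 d^{\mathrm{new}}(n)$ and multiplicity $d(n)+d^{\mathrm{new}}(n)-i$ if $d(n)+\tfrac12 d^{\mathrm{new}}(n)\le i<d(n)+d^{\mathrm{new}}(n)$. Set $G(w,t)=\sum_{i\ge0}g_i(w)t^i$ and $G_\kappa(t)=G(w_\kappa,t)\in\mathbf C_p[[t]]$. For a series $\sum a_it^i$, its Newton polygon $\mathrm{NP}$ is the lower convex hull of the points $(i,v_p(a_i))$; its slopes are listed with multiplicity (each segment's slope repeated as many times as its horizontal length). *)

(* Defs.v *)
From HB Require Import structures.
From mathcomp Require Import all_boot all_order all_algebra.
From mathcomp Require Import all_classical all_reals all_analysis.

Set Implicit Arguments.
Unset Strict Implicit.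
Unset Printing Implicit Defensive.

Import Order.TTheory GRing.Theory Num.Theory.

Local Open Scope classical_set_scope.
Local Open Scope ring_scope.

Section Cp.
Variables (R : realType) (C : closedFieldType) (v : C -> \bar R).

(* v-adic topological closure of A *)
Definition vclosure (A : set C) : set C :=
  [set x | forall M : R, exists2 a, A a & (M%:E <= v (x - a))%E].

Definition vcauchy (u : nat -> C) : Prop :=
  forall M : R, exists N, forall m n, (N <= m)%N -> (N <= n)%N ->
    (M%:E <= v (u m - u n))%E.

Definition vcvg (u : nat -> C) (l : C) : Prop :=
  forall M : R, exists N, forall n, (N <= n)%N -> (M%:E <= v (u n - l))%E.

Definition Qp : set C := vclosure (range (fun r : rat => ratr r)).
Definition Zp : set C := vclosure (range (fun m : int => m%:~R)).
Definition Zp_units : set C := [set z | Zp z /\ v z = 0%E].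

Definition algebraic_over_Qp (x : C) : Prop :=
  exists f : {poly C}, [/\ f != 0, forall i, Qp f`_i & root f x].

(* (C, v) is the completion of an algebraic closure of Q_p with v p = 1.
   This determines (C, v) up to isometric isomorphism: C is algebraically
   closed by its type, so the elements of C algebraic over Q_p (the closure
   of the rationals in C) form an algebraic closure of Q_p. *)
Record is_Cp (p : nat) : Prop := IsCp {
  vp_eqy : forall x, (v x = +oo%E) <-> (x = 0);
  vp_neqNy : forall x, v x <> -oo%E;
  vpM : forall x y, v (x * y) = (v x + v y)%E;
  vpD : forall x y, (Order.min (v x) (v y) <= v (x + y))%E;
  vp_p : v p%:R = 1%E;
  Cp_complete : forall u, vcauchy u -> exists l, vcvg u l;
  Cp_dense : forall x, vclosure algebraic_over_Qp x
}.

(* The lower boundary of the convex hull of the points (j, v (a j)), as a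
   function of the abscissa. A j with a j = 0 has v (a j) = +oo; since
   0 * +oo = 0 it contributes only when its weight c j is 0. *)
Definition newton_polygon (a : nat -> C) (x : R) : \bar R :=
  ereal_inf [set y | exists (N : nat) (c : 'I_N -> R),
    [/\ forall j, 0 <= c j, \sum_j c j = 1, \sum_j c j * j%:R = x &
        y = (\sum_j (c j)%:E * v (a j))%E]].

(* The i-th slope (i >= 1), counted with multiplicity: the vertices have
   integral abscissae, so it is the slope of the side lying over [i - 1, i]. *)
Definition NP_slope (a : nat -> C) (i : nat) : \bar R :=
  (newton_polygon a i%:R - newton_polygon a (i%:R - 1))%E.

End Cp.

Definition delta (p : nat) : nat := if p == 2 then 2 else p.-1.
Definition qq (p : nat) : nat := if p == 2 then 4 else p.

Section Weights.
Variables (R : realType) (C : closedFieldType) (v : C -> \bar R).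
Variables (p k0 : nat).

(* A character is represented by a function on C, of which only the values on
   Zp_units matter. *)
Definition weight_space : set (C -> C) := [set kappa |
  [/\ forall z, Zp_units v z -> kappa z != 0,
      forall z t, Zp_units v z -> Zp_units v t ->
        kappa (z * t) = kappa z * kappa t,
      forall z, Zp_units v z -> forall M : R, exists L : R,
        forall t, Zp_units v t -> (L%:E <= v (t - z))%E ->
          (M%:E <= v (kappa t - kappa z))%E &
      forall z m, Zp_units v z -> (0 < m)%N -> z ^+ m = 1 ->
        kappa z = z ^+ k0]].

Definition one_plus_2pZp : set C :=
  [set 1 + (2 * p)%:R * z | z in Zp v].

Definition top_generator (gamma : C) : Prop :=
  one_plus_2pZp gamma /\
  one_plus_2pZp `<=` vclosure v (range (fun m : int => gamma ^ m)).

Definition wcoord (gamma : C) (kappa : C -> C) : C :=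
  if (p == 2) && (k0 == 1) then kappa gamma * gamma^-1 - 1
  else kappa gamma - 1.

Definition kn (n : int) : int := k0%:Z + n * (delta p)%:Z.

Definition int_weight (k : int) : C -> C := fun z => z ^ k.

End Weights.

Section IntegerWeights.
Variables (R : realType) (C : closedFieldType) (v : C -> \bar R) (p : nat).

Lemma vp0 : is_Cp v p -> v 0 = +oo%E.
Proof. by move=> hC; apply/(vp_eqy hC). Qed.

Lemma vp_fin (x : C) : is_Cp v p -> x != 0 -> v x \is a fin_num.
Proof.
move=> hC /eqP x0; have := vp_eqy hC x; have := @vp_neqNy _ _ _ _ hC x.
by case: (v x) => // _ [/(_ erefl)].
Qed.

Lemma vp1 : is_Cp v p -> v 1 = 0%E.
Proof.
move=> hC; have := vpM hC 1 1; have := vp_fin hC (oner_neq0 C).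
rewrite mulr1; case: (v 1) => // r _ [] /eqP.
by rewrite -subr_eq0 opprD addrA subrr sub0r oppr_eq0 => /eqP ->.
Qed.

Lemma vpN (x : C) : is_Cp v p -> v (- x) = v x.
Proof.
move=> hC; rewrite -mulN1r (vpM hC).
suff -> : v (-1) = 0%E by rewrite add0e.
have N1 : v (-1) \is a fin_num by apply: vp_fin => //; rewrite oppr_eq0 oner_eq0.
have := vpM hC (-1) (-1); rewrite mulrNN mulr1 (vp1 hC).
case: (v (-1)) N1 => // r _ [] /esym/eqP; rewrite -mulr2n -mulr_natr mulf_eq0.
by rewrite pnatr_eq0 orbF => /eqP ->.
Qed.

Lemma vp_leD (M : \bar R) (x y : C) : is_Cp v p ->
  (M <= v x)%E -> (M <= v y)%E -> (M <= v (x + y))%E.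
Proof. by move=> hC ? ?; apply: le_trans (vpD hC x y); rewrite le_min; apply/andP. Qed.

Lemma vp_leB (M : \bar R) (x y : C) : is_Cp v p ->
  (M <= v x)%E -> (M <= v y)%E -> (M <= v (x - y))%E.
Proof. by move=> hC ? ?; apply: vp_leD => //; rewrite vpN. Qed.

Lemma vp_lesum (M : \bar R) (n : nat) (F : nat -> C) : is_Cp v p ->
  (forall i, (i < n)%N -> (M <= v (F i))%E) -> (M <= v (\sum_(i < n) F i))%E.
Proof.
move=> hC; elim: n => [|n IH] h; first by rewrite big_ord0 vp0// leey.
rewrite big_ord_recr /=; apply: vp_leD => //; last exact: h.
by apply: IH => i /ltnW; exact: h.
Qed.

Lemma vp_natr_ge0 (n : nat) : is_Cp v p -> (0 <= v n%:R)%E.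
Proof.
move=> hC; elim: n => [|n IH]; first by rewrite vp0// leey.
by rewrite -natr1; apply: vp_leD => //; rewrite vp1.
Qed.

Lemma vp_intr_ge0 (m : int) : is_Cp v p -> (0 <= v m%:~R)%E.
Proof.
by move=> hC; case: m => n; rewrite ?NegzE ?mulrNz ?vpN//; exact: vp_natr_ge0.
Qed.

Lemma vpX_unit (z : C) (n : nat) : is_Cp v p -> v z = 0%E -> v (z ^+ n) = 0%E.
Proof.
move=> hC z0; elim: n => [|n IH]; first by rewrite vp1.
by rewrite exprS (vpM hC) z0 IH adde0.
Qed.

Lemma vp_unit_neq0 (z : C) : is_Cp v p -> v z = 0%E -> z != 0.
Proof. by move=> hC z0; apply/eqP => zE; move: z0; rewrite zE (vp0 hC). Qed.

Lemma vp_subX_ge (t z : C) (n : nat) : is_Cp v p -> v t = 0%E -> v z = 0%E ->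
  (v (t - z) <= v (t ^+ n - z ^+ n))%E.
Proof.
move=> hC t0 z0; rewrite subrXX (vpM hC) leeDl//.
apply: (@vp_lesum _ _ (fun i => t ^+ (n.-1 - i) * z ^+ i)) => // i _.
by rewrite (vpM hC) !vpX_unit// adde0.
Qed.

Lemma vpV_unit (z : C) : is_Cp v p -> v z = 0%E -> v z^-1 = 0%E.
Proof.
move=> hC z0; have := vpM hC z z^-1.
by rewrite mulfV ?vp_unit_neq0// vp1// z0 add0e.
Qed.

Lemma vp_subXz_ge (t z : C) (k : int) : is_Cp v p -> v t = 0%E -> v z = 0%E ->
  (v (t - z) <= v (t ^ k - z ^ k))%E.
Proof.
move=> hC t0 z0; case: k => n; first exact: vp_subX_ge.
rewrite /exprz /= -!exprVn.
have -> : t - z = - (t * z) * (t^-1 - z^-1).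
  rewrite mulrBr !mulNr opprK mulrAC mulfV ?vp_unit_neq0// mul1r.
  by rewrite -mulrA mulfV ?vp_unit_neq0// mulr1 addrC.
rewrite (vpM hC) vpN// (vpM hC) t0 z0 !add0e.
by apply: vp_subX_ge; rewrite ?vpV_unit.
Qed.

Lemma vp_prime_neq (l : nat) : is_Cp v p -> prime p -> prime l -> l != p ->
  v l%:R = 0%E.
Proof.
move=> hC pp pl lp.
have cop : coprime l p by rewrite prime_coprime// dvdn_prime2.
have := egcdnP p (prime_gt0 pl) => -[a b ab _].
rewrite (eqP cop) in ab.
have : v (a * l)%:R = 0%E.
  rewrite ab natrD natrM.
  apply/eqP; rewrite eq_le; apply/andP; split; last first.
    by apply: vp_leD => //; rewrite ?vp1// -natrM vp_natr_ge0.
  rewrite leNgt; apply/negP => h.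
  have : (Order.min (v (b%:R * p%:R + 1)) (v (b%:R * p%:R)) <= v 1)%E.
    have := vpD hC (b%:R * p%:R + 1) (- (b%:R * p%:R)).
    by rewrite vpN// addrAC subrr add0r.
  rewrite vp1// leNgt => /negP; apply; rewrite lt_min h /=.
  rewrite (vpM hC) (vp_p hC).
  have := vp_natr_ge0 b hC; case: (v b%:R) => //= r.
  rewrite lee_fin -EFinD lte_fin => r0; exact: ltr_wpDl.
rewrite natrM (vpM hC); have := vp_natr_ge0 a hC; have := vp_natr_ge0 l hC.
case: (v l%:R) (v a%:R) => [x||] [y||] //=; rewrite !lee_fin => x0 y0 [] /eqP.
by rewrite paddr_eq0// => /andP[_ /eqP ->].
Qed.

Lemma vp_sub1X_ge (M : \bar R) (y : C) (n : nat) : is_Cp v p -> v y = 0%E ->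
  (M <= v (y - 1))%E -> (M <= v (y ^+ n - 1))%E.
Proof.
move=> hC y0 /le_trans; apply; rewrite -{2}(expr1n C n).
by apply: vp_subX_ge; rewrite ?vp1.
Qed.

(* If y <> 1 and M0 <= v (y - 1) then y is not a root of unity. *)
Let M0 : \bar R := (if p == 2 then 2 else 1)%:E.

Lemma torsion_free_prime (y : C) (l : nat) : is_Cp v p -> prime p ->
  prime l -> v y = 0%E -> (M0 <= v (y - 1))%E -> y ^+ l = 1 -> y = 1.
Proof.
move=> hC pp pl y0 hy yl; apply: contrapT => /eqP y1.
have hy1 : (1%:E <= v (y - 1))%E.
  by apply: le_trans hy; rewrite /M0; case: ifP => _; rewrite lee_fin// ler1n.
have S0 : \sum_(i < l) y ^+ i = 0.
  have /eqP := subrX1 y l; rewrite yl subrr eq_sym mulf_eq0 subr_eq0.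
  by rewrite (negbTE y1) => /eqP.
have lE : l%:R = - (\sum_(i < l) (y ^+ i - 1)) :> C.
  by rewrite sumrB S0 sub0r opprK sumr_const card_ord.
have vl1 : (1%:E <= v l%:R)%E.
  rewrite lE vpN//; apply: (@vp_lesum _ _ (fun i => y ^+ i - 1)) => // i _.
  exact: vp_sub1X_ge.
have [lp|lp] := eqVneq l p; last by move: vl1; rewrite vp_prime_neq// lee_fin ler10.
subst l; have vl2 : (2%:E <= v p%:R)%E; last first.
  by move: vl2; rewrite (vp_p hC) lee_fin (ler_nat _ 2 1).
have [p2|p2] := eqVneq p 2.
  rewrite lE p2 vpN// big_ord_recr big_ord1 /= expr0 subrr add0r expr1.
  by move: hy; rewrite /M0 p2.
rewrite lE vpN//.
have -> : \sum_(i < p) (y ^+ i - 1) =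
    (y - 1) * ((binomial p 2)%:R + \sum_(i < p) \sum_(j < i) (y ^+ j - 1)).
  rewrite -bin2_sum big_mkord natr_sum -big_split /= mulr_sumr.
  apply: eq_bigr => i _; rewrite subrX1; congr (_ * _).
  by rewrite sumrB sumr_const card_ord addrC subrK.
have -> : (2%:E = 1%:E + 1%:E :> \bar R)%E by rewrite -EFinD -natr1.
rewrite (vpM hC); apply: leeD => //; apply: vp_leD => //.
  have /dvdnP[m ->] : (p %| binomial p 2)%N.
    by apply: prime_dvd_bin => //=; rewrite ltn_neqAle eq_sym p2 prime_gt1.
  rewrite natrM (vpM hC) (vp_p hC) leeDr//; exact: vp_natr_ge0.
apply: (@vp_lesum _ _ (fun i => \sum_(j < i) (y ^+ j - 1))) => // i _.
apply: (@vp_lesum _ _ (fun j => y ^+ j - 1)) => // j _.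
exact: vp_sub1X_ge.
Qed.

Lemma torsion_free (m : nat) (y : C) : is_Cp v p -> prime p -> (0 < m)%N ->
  v y = 0%E -> (M0 <= v (y - 1))%E -> y ^+ m = 1 -> y = 1.
Proof.
move=> hC pp; elim/ltn_ind: m y => m IH y m0 y0 hy ym.
have [m1|m1] := leqP m 1.
  by have mE : m = 1 by [apply/eqP; rewrite eqn_leq m1]; rewrite mE in ym.
have pl := pdiv_prime m1; have dl := pdiv_dvd m.
apply: (@torsion_free_prime y (pdiv m)) => //.
apply: (IH (m %/ pdiv m)%N); rewrite ?vpX_unit//.
- by rewrite ltn_Pdiv// prime_gt1.
- by rewrite divn_gt0 ?prime_gt0// dvdn_leq.
- exact: vp_sub1X_ge.
- by rewrite -exprM mulnC divnK.
Qed.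

Lemma vp_dvdn (k m : nat) : is_Cp v p -> (p ^ k %| m)%N -> (k%:R%:E <= v m%:R)%E.
Proof.
move=> hC /dvdnP[a ->]; elim: k => [|k IH]; first exact: vp_natr_ge0.
rewrite expnSr mulnA natrM (vpM hC) (vp_p hC) -natr1 EFinD.
exact: leeD.
Qed.

Lemma vp_unit_nat (a : nat) : is_Cp v p -> v a%:R = 0%E -> ~~ (p %| a)%N.
Proof.
move=> hC a0; apply/negP => pa; have := @vp_dvdn 1 a hC pa.
by rewrite a0 lee_fin ler10.
Qed.

Lemma unit_Xdelta (z : C) : is_Cp v p -> prime p -> Zp_units v z ->
  (M0 <= v (z ^+ delta p - 1))%E.
Proof.
move=> hC pp [zZ z0].
have [_ [m _ <-] hm] := zZ 2.
have hM : (M0 <= v (z - m%:~R))%E.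
  by apply: le_trans hm; rewrite /M0; case: ifP => _; rewrite lee_fin// ler1n.
have M00 : (0 < M0)%E by rewrite /M0; case: ifP => _; rewrite lte_fin.
have vm : v m%:~R = 0%E.
  apply/eqP; rewrite eq_le; apply/andP; split; last exact: vp_intr_ge0.
  rewrite leNgt; apply/negP => h.
  have := vpD hC (z - m%:~R) m%:~R; rewrite subrK z0 leNgt lt_min h andbT.
  by rewrite (lt_le_trans M00 hM).
have dodd : ~~ odd (delta p).
  rewrite /delta; case: eqVneq => // p2.
  have [pE|] := even_prime pp; first by rewrite pE in p2.
  by case: (p) => // q.
have [a ma va] : exists2 a : nat,
    (m%:~R : C) ^+ delta p = a%:R ^+ delta p & v a%:R = 0%E.
  case: (m) vm => n vn; first by exists n.
  exists n.+1; last by rewrite -(vpN _ hC) -vn NegzE mulrNz.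
  by rewrite NegzE mulrNz exprNn -signr_odd (negbTE dodd) expr0 mul1r.
have -> : z ^+ delta p - 1 =
    (z ^+ delta p - m%:~R ^+ delta p) + (m%:~R ^+ delta p - 1).
  by rewrite addrA subrK.
apply: vp_leD => //; first by apply: (le_trans hM); exact: vp_subX_ge.
have pa := vp_unit_nat hC va.
have a0 : (0 < a)%N by case: (a) pa => //; rewrite dvdn0.
have -> : m%:~R ^+ delta p - 1 = ((a ^ delta p - 1)%N)%:R :> C.
  by rewrite ma natrB ?natrX// expn_gt0 a0.
rewrite /M0 /delta; case: eqVneq => p2.
  apply: (@vp_dvdn 2) => //; move: pa; rewrite p2 dvdn2 negbK => oa.
  rewrite -(odd_double_half a) oa add1n -[1%N](exp1n 2) subn_sqr.
  rewrite subn1 addn1 /= -doubleS -!muln2 mulnACA; exact: dvdn_mull.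
apply: (@vp_dvdn 1) => //; rewrite expn1.
have cop : coprime p a by rewrite prime_coprime.
rewrite -(Gauss_dvdr _ cop) mulnBr muln1 -expnS prednK ?prime_gt0//.
rewrite -eqn_mod_dvd; first by apply/eqP; exact: fermat_little.
by rewrite -{1}[a]expn1 leq_pexp2l// prime_gt0.
Qed.

Lemma int_weight_in_weight_space (k0 : nat) (n : int) : is_Cp v p -> prime p ->
  weight_space v k0 (int_weight (kn p k0 n)).
Proof.
move=> hC pp; rewrite /int_weight; split.
- by move=> z [_ z0]; apply: expfz_neq0; exact: vp_unit_neq0.
- by move=> z t _ _; exact: expfzMl.
- move=> z [_ z0] M; exists M => t [_ t0] /le_trans; apply.
  exact: vp_subXz_ge.
move=> z m zU m0 zm; have [_ z0] := zU.
have zd : z ^+ delta p = 1.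
  apply: (@torsion_free m) => //; first exact: vpX_unit.
    exact: unit_Xdelta.
  by rewrite exprAC zm expr1n.
rewrite /kn expfzDr ?(vp_unit_neq0 hC)// [n * _]mulrC -exprz_exp.
by have -> : z ^ (delta p)%:Z = 1 by []; rewrite exp1rz mulr1.
Qed.

End IntegerWeights.

Section Ghost.
Variables (C : closedFieldType) (p k0 : nat) (gamma : C) (d dnew : int -> int).

Definition ghost_mult (i : nat) (n : int) : nat :=
  if (d n < i%:Z)%R && (i%:Z < d n + dnew n)%R then
    (* the test says i <= d n + dnew n / 2; the absolute values are those of
       nonnegative integers *)
    if (2 * i%:Z <= 2 * d n + dnew n)%R then absz (i%:Z - d n)%R
    else absz (d n + dnew n - i%:Z)%R
  else 0.

(* The product ranges over all n in Z; all but finitely many factors are 1 as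
   soon as d n -> +oo at +oo and d n + dnew n -> -oo at -oo. *)
Definition ghost_poly (i : nat) : {poly C} :=
  \big[*%R/1]_(n \in [set: int])
    ('X - (wcoord p k0 gamma (int_weight (kn p k0 n)))%:P)
      ^+ ghost_mult i n.

(* coefficients of G_kappa(t) *)
Definition ghost_series (kappa : C -> C) (i : nat) : C :=
  (ghost_poly i).[wcoord p k0 gamma kappa].

End Ghost.

Section Hypotheses.
Variables (d dnew : int -> int).

Definition hypG : Prop :=
  (forall M : int, exists N : int, forall n, N <= n -> M <= d n) /\
  (forall M : int, exists N : int, forall n, n <= N -> d n + dnew n <= M).

Definition hypND : Prop :=
  [/\ {homo d : m n / m <= n},
      {homo (fun n => d n + dnew n) : m n / m <= n} &
      {homo (fun n => 2 * d n + dnew n) : m n / m <= n}].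

Definition hypLG (R : realType) (A B : R) : Prop :=
  [/\ 0 < A, 0 < B,
      exists K : R, exists N : int, forall n, N <= n ->
        `|(d n)%:~R - A * n%:~R| <= K &
      exists K : R, exists N : int, forall n, N <= n ->
        `|(dnew n)%:~R - B * n%:~R| <= K].

End Hypotheses.

(* Main.v *)
(* By (ND) the difference mult_i(k_m) - mult_(i-1)(k_m) is the indicator of an
   interval of m's minus the indicator of another one, and by (LG) the end
   points of these intervals are known up to O(1).  Since v(w_(k_m) - w_(k_n))
   is a constant plus v_p(m - n), whose average over a long interval is 1/(p-1)
   with a logarithmic error (Legendre's formula), the heights
   v(g_i(w_(k_n))), computed without the zero of G at m = n, have increments
   D i + O(log(n + i)).  The actual heights differ from these only for
   d(n) < i < d(n) + dnew(n), where they are infinite.  For n large, the slope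
   over a gap (j, k) between consecutive finite heights is then the average of
   D i over j < i <= k, up to O(log(n + k)); the gap is (i - 1, i) in cases (a)
   and (c), and (d(n), d(n) + dnew(n)) in case (b). *)
Require Import Defs.
From HB Require Import structures.
From mathcomp Require Import all_boot all_order all_algebra.
From mathcomp Require Import all_classical all_reals all_analysis.
From mathcomp Require Import ring lra zify.

Set Implicit Arguments.
Unset Strict Implicit.
Unset Printing Implicit Defensive.

Import Order.TTheory GRing.Theory Num.Theory.

Local Open Scope classical_set_scope.
Local Open Scope ring_scope.

(** * Newton polygons *)

Section NewtonPolygon.
Variables (R : realType) (C : closedFieldType) (v : C -> \bar R).
Variables (a : nat -> C) (S : pred nat) (h : nat -> R).
Hypothesis va : forall j, v (a j) = if S j then (h j)%:E else +oo%E.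
Hypothesis h_ge0 : forall j, S j -> 0 <= h j.

Local Notation NP := (newton_polygon v a).

(** Weights at equal abscissae are merged. Any finite type may index the combination, because moving
    mass adds a point to ['I_N]. *)
Lemma newton_polygon_le (I : finType) (f : I -> nat) (c : I -> R) :
  (forall t, 0 <= c t) -> \sum_t c t = 1 ->
  (forall t, c t != 0 -> S (f t)) ->
  (NP (\sum_t c t * (f t)%:R) <= (\sum_t c t * h (f t))%:E)%E.
Proof.
move=> c0 c1 cS; apply: ereal_inf_lbound => /=.
pose N := (\max_t f t).+1.
have fN t : (f t < N)%N by rewrite ltnS; exact: leq_bigmax.
pose F t : 'I_N := Ordinal (fN t).
exists N, (fun j : 'I_N => \sum_(t | F t == j) c t); split.
- by move=> j; apply: sumr_ge0 => t _.
- by rewrite -c1; rewrite (partition_big F predT).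
- rewrite (partition_big F predT) //=; apply: eq_bigr => j _.
  by rewrite mulr_suml; apply: eq_bigr => t /eqP <-.
- rewrite (partition_big F predT) //= -sumEFin; apply: eq_bigr => j _.
  rewrite va; case: ifPn => Sj.
    rewrite -EFinM mulr_suml; congr EFin.
    by apply: eq_bigr => t /eqP <-.
  have E0 t : F t == j -> c t = 0.
    move=> /eqP ftj; apply/eqP; apply: contraNT Sj => /cS.
    by rewrite -ftj.
  by rewrite !big1 ?mul0e// => t /E0 ->; rewrite mul0r.
Qed.

(** A combination with positive weight at an infinite height has value [+oo], so a lower bound need
    only be tested on combinations supported in [S]. *)
Lemma newton_polygon_glb (x : R) (y : \bar R) :
  (forall N (c : 'I_N -> R), (forall j, 0 <= c j) -> \sum_j c j = 1 ->
     (forall j, c j != 0 -> S j) -> \sum_j c j * j%:R = x ->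
     (y <= (\sum_j c j * h j)%:E)%E) ->
  (y <= NP x)%E.
Proof.
move=> H; apply: le_ereal_inf_tmp => _ [N [c [c0 c1 cx ->]]].
have [/forallP cS|] := boolP [forall j, (c j != 0) ==> S j].
  rewrite (_ : \sum_j _ = (\sum_j c j * h j)%:E)%E; last first.
    rewrite -sumEFin; apply: eq_bigr => j _; rewrite va.
    have := cS j; case: (eqVneq (c j) 0) => [->|_] /=; last by move=> ->.
    by rewrite mul0e mul0r.
  by apply: H => // j cj; have /implyP := cS j; apply.
rewrite negb_forall => /existsP[j]; rewrite negb_imply => /andP[cj Sj].
rewrite (_ : \sum_j _ = +oo)%E ?leey//; apply/eqP; rewrite esum_eqy.
  apply/existsP; exists j; rewrite /= va (negbTE Sj) gt0_muley//.
  by rewrite lte_fin lt_neqAle eq_sym cj c0.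
move=> k _; rewrite va; case: ifP => // _.
have := c0 k; rewrite le_eqVlt => /predU1P[<-|ck]; first by rewrite mul0e.
by rewrite gt0_muley.
Qed.

(* Moving a proportion t of the masses lying in P to the single point q. *)
Lemma newton_polygon_move N (c : 'I_N -> R) (P : pred nat) (q : nat) (t : R) :
  (forall j, 0 <= c j) -> \sum_j c j = 1 -> (forall j, c j != 0 -> S j) ->
  S q -> 0 <= t <= 1 ->
  (NP (\sum_j c j * j%:R + t * \sum_(j < N | P j) c j * (q%:R - j%:R)) <=
   (\sum_j c j * h j + t * \sum_(j < N | P j) c j * (h q - h j))%:E)%E.
Proof.
move=> c0 c1 cS Sq /andP[t0 t1].
pose f (s : 'I_N + 'I_1) : nat := match s with inl j => j | inr _ => q end.
pose c' (s : 'I_N + 'I_1) : R := match s with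
  | inl j => c j - (if P j then t * c j else 0)
  | inr _ => t * \sum_(j < N | P j) c j end.
(* Used for the abscissae, for the heights and, with [g] constant 1, for the total mass. *)
have E (g : nat -> R) : \sum_j c j * g j + t * \sum_(j < N | P j) c j * (g q - g j)
    = \sum_s c' s * g (f s).
  rewrite big_sumType /= big_ord1.
  have -> : \sum_j (c j - (if P j then t * c j else 0)) * g j =
      \sum_j c j * g j - \sum_(j < N | P j) t * c j * g j.
    rewrite [X in _ = _ - X]big_mkcond -sumrB; apply: eq_bigr => j _.
    by case: ifP => _; rewrite ?subr0// mulrBl.
  rewrite -addrA; congr (_ + _).
  rewrite !mulr_sumr mulr_suml addrC -sumrB.
  by apply: eq_bigr => j _; ring.
rewrite !E; apply: newton_polygon_le => [[j|_]||[j|_]] //=.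
- have := c0 j; case: ifP => _; last by rewrite subr0.
  by move=> ?; rewrite subr_ge0 ler_piMl.
- by rewrite mulr_ge0// sumr_ge0.
- have cM J (F : J -> R) (s : seq J) : \sum_(j <- s) F j * 1 = \sum_(j <- s) F j.
    by apply: eq_bigr => j _; rewrite mulr1.
  have := E (fun=> 1); rewrite !cM c1 => <-.
  by rewrite big1 ?mulr0 ?addr0// => j _; rewrite subrr mulr0.
- move=> cj; apply: cS; apply: contra_neq cj => ->.
  by rewrite mulr0 if_same subrr.
Qed.

(** From a combination over i, move to [j0] the proportion of the mass at or beyond i that lowers
    the barycentre by 1. The moved points lie above the line of slope [mu] through [j0], so the
    height falls by at least [mu]. *)
Lemma newton_polygon_step_ge (i j0 : nat) (mu : R) :
  (j0 < i)%N -> S j0 ->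
  (forall k, (i <= k)%N -> S k -> h j0 + mu * (k%:R - j0%:R) <= h k) ->
  (NP (i%:R - 1) + mu%:E <= NP i%:R)%E.
Proof.
move=> j0i Sj0 H; apply: newton_polygon_glb => N c c0 c1 cS cx.
rewrite -leeBrDr//.
pose P := [pred k : nat | (i <= k)%N].
set M := \sum_(j < N | P j) c j * (j%:R - j0%:R).
have cE : \sum_j c j * (j%:R - j0%:R) = i%:R - j0%:R.
  under eq_bigr do rewrite mulrBr.
  by rewrite sumrB cx -mulr_suml c1 mul1r.
(* The mass before i accounts for at most i - 1 - j0 of the total first moment i - j0 about [j0]. At
   least 1 remains, which makes [M^-1] an admissible proportion. *)
have M1 : 1 <= M.
  have : \sum_(j < N | ~~ P j) c j * (j%:R - j0%:R) <=
      \sum_(j < N | ~~ P j) c j * (i%:R - 1 - j0%:R).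
    apply: ler_sum => j; rewrite /= -ltnNge => ji; apply: ler_wpM2l => //.
    by rewrite lerD2r lerBrDr natr1 ler_nat.
  have : \sum_(j < N | ~~ P j) c j * (i%:R - 1 - j0%:R) <= i%:R - 1 - j0%:R.
    rewrite -mulr_suml ler_piMl//.
      by rewrite subr_ge0 lerBrDr natr1 ler_nat.
    by rewrite -c1 [leRHS](bigID (fun j : 'I_N => P j)) /= lerDr sumr_ge0.
  move: cE; rewrite (bigID (fun j : 'I_N => P j)) /= -/M; lra.
have M0 : 0 < M by exact: lt_le_trans M1.
have t01 : 0 <= M^-1 <= 1 by rewrite invr_ge0 ltW//= invf_le1.
have := @newton_polygon_move N c P j0 M^-1 c0 c1 cS Sj0 t01.
rewrite cx (_ : \sum_(j < N | P j) c j * (j0%:R - j%:R) = - M); last first.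
  by rewrite -sumrN; apply: eq_bigr => j _; ring.
rewrite mulrN mulVf ?gt_eqF// => /le_trans; apply.
rewrite -EFinB lee_fin lerD2l lerNr -mulrN ler_pdivlMl// -sumrN.
rewrite /M mulr_suml; apply: ler_sum => j Pj.
rewrite -mulrN -mulrA opprB.
have := c0 j; rewrite le_eqVlt => /predU1P[<-|cj]; first by rewrite !mul0r.
rewrite ler_wpM2l ?(ltW cj)// mulrC lerBrDl; apply: H => //.
by apply: cS; rewrite gt_eqF.
Qed.

(** The mirror image: over i - 1, a proportion of the mass before i moves to [k0]. *)
Lemma newton_polygon_step_le (i k0 : nat) (nu : R) :
  (1 <= i)%N -> (i <= k0)%N -> S k0 ->
  (forall j, (j < i)%N -> S j -> h k0 - nu * (k0%:R - j%:R) <= h j) ->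
  (NP i%:R <= NP (i%:R - 1) + nu%:E)%E.
Proof.
move=> i1 ik0 Sk0 H; rewrite -leeBlDr//.
apply: newton_polygon_glb => N c c0 c1 cS cx.
rewrite leeBlDr//.
pose P := [pred j : nat | (j < i)%N].
set M := \sum_(j < N | P j) c j * (k0%:R - j%:R).
have cE : \sum_j c j * (k0%:R - j%:R) = k0%:R - i%:R + 1.
  under eq_bigr do rewrite mulrBr.
  by rewrite sumrB cx -mulr_suml c1 mul1r opprB addrA addrAC.
have M1 : 1 <= M.
  have : \sum_(j < N | ~~ P j) c j * (k0%:R - j%:R) <=
      \sum_(j < N | ~~ P j) c j * (k0%:R - i%:R).
    apply: ler_sum => j; rewrite /= -leqNgt => ji; apply: ler_wpM2l => //.
    by rewrite lerD2l lerN2 ler_nat.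
  have : \sum_(j < N | ~~ P j) c j * (k0%:R - i%:R) <= k0%:R - i%:R.
    rewrite -mulr_suml ler_piMl//; first by rewrite subr_ge0 ler_nat.
    by rewrite -c1 [leRHS](bigID (fun j : 'I_N => P j)) /= lerDr sumr_ge0.
  move: cE; rewrite (bigID (fun j : 'I_N => P j)) /= -/M; lra.
have M0 : 0 < M by exact: lt_le_trans M1.
have t01 : 0 <= M^-1 <= 1 by rewrite invr_ge0 ltW//= invf_le1.
have := @newton_polygon_move N c P k0 M^-1 c0 c1 cS Sk0 t01.
rewrite cx -/M mulVf ?gt_eqF// subrK => /le_trans; apply.
rewrite -EFinD lee_fin lerD2l ler_pdivrMl//.
rewrite /M mulr_suml; apply: ler_sum => j Pj.
rewrite -mulrA.
have := c0 j; rewrite le_eqVlt => /predU1P[<-|cj]; first by rewrite !mul0r.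
rewrite ler_wpM2l ?(ltW cj)// mulrC lerBlDl -lerBlDr; apply: H => //.
by apply: cS; rewrite gt_eqF.
Qed.

(** This keeps the difference in [NP_slope] meaningful. Heights are nonnegative, and the chord from
    [j0] to [k0] bounds the polygon from above at i - 1. *)
Lemma newton_polygon_fin_num (i j0 k0 : nat) :
  (1 <= i)%N -> (j0 < i)%N -> (i <= k0)%N -> S j0 -> S k0 ->
  NP (i%:R - 1) \is a fin_num.
Proof.
move=> i1 j0i ik0 Sj0 Sk0; rewrite fin_numElt; apply/andP; split.
  apply: (@lt_le_trans _ _ 0%E) => //.
  apply: newton_polygon_glb => N c c0 c1 cS _; rewrite lee_fin sumr_ge0//.
  move=> j _; have [->|cj] := eqVneq (c j) 0; first by rewrite mul0r.
  by rewrite mulr_ge0 ?h_ge0// cS.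
pose c (b : bool) : R := (if b then i%:R - 1 - j0%:R else k0%:R - (i%:R - 1))
   / (k0%:R - j0%:R).
pose f (b : bool) := if b then k0 else j0.
have jk : 0 < k0%:R - j0%:R :> R by rewrite subr_gt0 ltr_nat (leq_trans j0i).
have bs (g : bool -> R) : \sum_b g b = g true + g false by rewrite big_bool.
have j0iR : j0%:R + 1 <= i%:R :> R by rewrite natr1 ler_nat.
have ik0R : i%:R <= k0%:R :> R by rewrite ler_nat.
have := @newton_polygon_le _ f c.
rewrite !bs /f /c /=.
have cx : (i%:R - 1 - j0%:R) / (k0%:R - j0%:R) * k0%:R +
    (k0%:R - (i%:R - 1)) / (k0%:R - j0%:R) * j0%:R = i%:R - 1 :> R.
  by field; rewrite gt_eqF.
rewrite cx => H; apply: le_lt_trans (H _ _ _) _; last exact: ltry.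
- by move=> [] /=; rewrite divr_ge0 ?(ltW jk)//; lra.
- by field; rewrite gt_eqF.
- by case.
Qed.

Lemma NP_slope_bounds (i j0 k0 : nat) (mu nu : R) :
  (1 <= i)%N -> (j0 < i)%N -> (i <= k0)%N -> S j0 -> S k0 ->
  (forall k, (i <= k)%N -> S k -> h j0 + mu * (k%:R - j0%:R) <= h k) ->
  (forall j, (j < i)%N -> S j -> h k0 - nu * (k0%:R - j%:R) <= h j) ->
  (mu%:E <= NP_slope v a i <= nu%:E)%E.
Proof.
move=> i1 j0i ik0 Sj0 Sk0 Hmu Hnu; rewrite /NP_slope.
have fin := newton_polygon_fin_num i1 j0i ik0 Sj0 Sk0.
have := newton_polygon_step_ge j0i Sj0 Hmu.
have := newton_polygon_step_le i1 ik0 Sk0 Hnu.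
move: fin; case: (NP (i%:R - 1)) => // x _; case: (NP i%:R) => // y.
by rewrite -!EFinD !lee_fin => ? ?; apply/andP; split; lra.
Qed.
End NewtonPolygon.

(** * Valuations of the coefficients of the ghost series *)

Section Valuations.
Variables (R : realType) (C : closedFieldType) (v : C -> \bar R) (p : nat).
Hypotheses (hC : is_Cp v p) (pp : prime p).

Lemma vp_add_dominant (x y : C) : (v x < v y)%E -> v (x + y) = v x.
Proof.
move=> xy; apply/eqP; rewrite eq_le; apply/andP; split; last first.
  by apply: (vp_leD hC) => //; exact: ltW.
rewrite leNgt; apply/negP => h.
have := vpD hC (x + y) (- y); rewrite addrK (vpN _ hC) leNgt => /negP; apply.
by rewrite lt_min h.
Qed.

Lemma vp_near_unit (y : C) (r : R) : 0 < r -> (r%:E <= v (y - 1))%E -> v y = 0%E.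
Proof.
move=> r0 ry; rewrite -(subrKC 1 y) vp_add_dominant ?vp1//.
  exact: (vp1 hC).
by rewrite (vp1 hC); apply: lt_le_trans ry; rewrite lte_fin.
Qed.

Lemma Zp_ge0 (z : C) : Defs.Zp v z -> (0 <= v z)%E.
Proof.
move=> /(_ 0)[_ [m _ <-] hm]; rewrite -(subrK m%:~R z).
by apply: (vp_leD hC) => //; exact: (vp_intr_ge0 _ hC).
Qed.

Lemma vp_nat_unit (m : nat) : ~~ (p %| m)%N -> v m%:R = 0%E.
Proof.
elim/ltn_ind: m => m IH pm.
have [m1|m1] := leqP m 1.
  move: m1 pm; case: (m) => [|[|//]] _; first by rewrite dvdn0.
  by rewrite (vp1 hC).
have pl := pdiv_prime m1; have dl := pdiv_dvd m.
have lp : pdiv m != p by apply: contraNneq pm => <-.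
rewrite -(divnK dl) natrM (vpM hC) (vp_prime_neq hC pp pl lp) adde0.
apply: IH; first by rewrite ltn_Pdiv ?prime_gt1// ltnW.
by apply: contra pm => /dvdn_trans; apply; rewrite dvdn_div.
Qed.

(** The valuation of 2p, and the bound on v(y - 1) from which y -> y^p raises v(y - 1) by exactly 1;
    for p = 2 the bound 1 would fail at y = -1. *)
Definition v2p : nat := (if p == 2 then 2 else 1)%N.

Lemma vp_2p : v (2 * p)%:R = v2p%:R%:E.
Proof.
rewrite natrM (vpM hC) (vp_p hC) /v2p; case: eqVneq => [p2|p2].
  have -> : v 2%:R = 1%E by rewrite -p2 (vp_p hC).
  by rewrite -EFinD -natr1.
by rewrite (vp_prime_neq hC)// ?add0e// eq_sym.
Qed.

Lemma v2p_ge1 : 1 <= v2p%:R :> R.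
Proof. by rewrite ler1n /v2p; case: ifP. Qed.

Lemma sum_expr_sub1 (y : C) m :
  \sum_(i < m) y ^+ i = m%:R + \sum_(i < m) (y ^+ i - 1).
Proof. by rewrite sumrB sumr_const card_ord addrC subrK. Qed.

(** In y^m - 1 = (y - 1)(1 + y + ... + y^(m-1)) the second factor is m plus terms of positive
    valuation, hence a unit. *)
Lemma vp_X_sub1_prime_to_p (y : C) (r : R) m : v2p%:R <= r ->
  v (y - 1) = r%:E -> ~~ (p %| m)%N -> v (y ^+ m - 1) = r%:E.
Proof.
move=> re yr pm; have r0 : 0 < r by apply: lt_le_trans re; have := v2p_ge1; lra.
have y0 : v y = 0%E by apply: (vp_near_unit r0); rewrite yr.
have m0 := vp_nat_unit pm.
rewrite subrX1 (vpM hC) yr sum_expr_sub1 vp_add_dominant; rewrite m0 ?adde0//.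
apply: (@lt_le_trans _ _ r%:E); first by rewrite lte_fin.
apply: (vp_lesum (F := fun i => y ^+ i - 1) hC) => // i _.
by apply: (vp_sub1X_ge _ hC); rewrite ?yr.
Qed.

(** The cofactor of y - 1 is p plus the sum of the y^i - 1, and this sum has valuation at least 2:
    for p = 2 it is y - 1, otherwise it is y - 1 times a term of valuation at least 1, as p divides
    binomial(p, 2). *)
Lemma vp_X_sub1_p (y : C) (r : R) : v2p%:R <= r ->
  v (y - 1) = r%:E -> v (y ^+ p - 1) = (r + 1)%:E.
Proof.
move=> re yr; have r1 : 1 <= r by apply: le_trans re; exact: v2p_ge1.
have r0 : 0 < r by lra.
have y0 : v y = 0%E by apply: (vp_near_unit r0); rewrite yr.
have yX j : (1%:E <= v (y ^+ j - 1))%E.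
  by apply: (vp_sub1X_ge _ hC) => //; rewrite yr lee_fin.
rewrite subrX1 (vpM hC) yr sum_expr_sub1 vp_add_dominant (vp_p hC)//.
apply: (@lt_le_trans _ _ 2%:E); first by rewrite lte_fin ltr1n.
have [p2|p2] := eqVneq p 2.
  rewrite p2 big_ord_recr big_ord1 /= expr0 subrr add0r expr1 yr lee_fin.
  by move: re; rewrite /v2p p2.
have -> : \sum_(i < p) (y ^+ i - 1) =
    (y - 1) * ((binomial p 2%N)%:R + \sum_(i < p) \sum_(j < i) (y ^+ j - 1)).
  rewrite -bin2_sum big_mkord natr_sum -big_split /= mulr_sumr.
  by apply: eq_bigr => i _; rewrite subrX1 sum_expr_sub1.
rewrite (vpM hC) yr (_ : 2 = 1 + 1 :> R)// EFinD leeD ?lee_fin//.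
apply: (vp_leD hC).
  apply: (@vp_dvdn _ _ _ _ 1%N _ hC); rewrite expn1.
  by apply: prime_dvd_bin => //=; rewrite ltn_neqAle eq_sym p2 prime_gt1.
apply: (vp_lesum (F := fun i => \sum_(j < i) (y ^+ j - 1)) hC) => // i _.
exact: (vp_lesum (F := fun j => y ^+ j - 1) hC).
Qed.

(** Lifting the exponent: each factor p of m raises [r] by 1, and the part of m prime to p changes
    nothing. *)
Lemma vp_X_sub1 (y : C) (r : R) m : (0 < m)%N -> v2p%:R <= r ->
  v (y - 1) = r%:E -> v (y ^+ m - 1) = (r + (logn p m)%:R)%:E.
Proof.
elim/ltn_ind: m y r => m IH y r m0 re yr.
have [pm|pm] := boolP (p %| m)%N; last first.
  by rewrite (vp_X_sub1_prime_to_p re yr pm) logn_coprime ?prime_coprime// addr0.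
have q0 : (0 < m %/ p)%N by rewrite divn_gt0 ?prime_gt0// dvdn_leq.
rewrite -(divnK pm) mulnC exprM (IH _ _ _ (r + 1))//.
- have lpp : logn p p = 1%N by rewrite logn_prime ?eqxx.
  by rewrite (lognM _ (prime_gt0 pp) q0) lpp natrD addrA.
- by rewrite ltn_Pdiv// prime_gt1.
- by apply: (le_trans re); rewrite lerDl.
- exact: vp_X_sub1_p.
Qed.

(** * Distances between the coordinates of integer weights *)

Variables (k0 : nat) (gamma : C).
Hypothesis hgamma : top_generator v p gamma.

(** Were v(gamma - 1) larger, all powers of gamma would be closer to 1 than 1 + 2p is, and could not
    approximate 1 + 2p. *)
Lemma vp_gamma_sub1 : v (gamma - 1) = v2p%:R%:E.
Proof.
have [[z zZ zg] gen] := hgamma.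
have ge : (v2p%:R%:E <= v (gamma - 1))%E.
  by rewrite -zg addrC addKr (vpM hC) vp_2p leeDl// Zp_ge0.
have g0 : v gamma = 0%E.
  by apply: (vp_near_unit (r := v2p%:R)) ge; have := v2p_ge1; lra.
apply/eqP; rewrite eq_le ge andbT leNgt; apply/negP => gt.
(* Precision 3 exceeds v(2p), which is at most 2. *)
have [|_ [m _ <-] hm] := gen (1 + (2 * p)%:R * 1) _ 3.
  exists 1 => // M; exists 1; first by exists 1.
  by rewrite subrr (vp0 hC) leey.
have := vpD hC (1 + (2 * p)%:R * 1 - gamma ^ m) (gamma ^ m - 1).
rewrite addrA subrK mulr1 addrC addKr vp_2p leNgt => /negP; apply.
rewrite lt_min; apply/andP; split.
  rewrite mulr1 in hm.
  by apply: lt_le_trans hm; rewrite lte_fin ltr_nat /v2p; case: ifP.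
apply: (lt_le_trans gt).
have := vp_subXz_ge m hC g0 (vp1 hC).
by rewrite exp1rz.
Qed.

Lemma vp_gamma : v gamma = 0%E.
Proof.
apply: (@vp_near_unit _ v2p%:R); first by have := v2p_ge1; lra.
by rewrite vp_gamma_sub1.
Qed.

(* The valuation of w_(k_m) - w_(k_n) for x = m - n <> 0; at x = 0 the junk value
   logn p 0 = 0 makes it finite. *)
Definition weight_dist (x : int) : nat :=
  (v2p + logn p (delta p) + logn p `|x|)%N.

Local Notation w n := (wcoord p k0 gamma (int_weight (kn p k0 n))).

Lemma delta_gt0 : (0 < delta p)%N.
Proof.
by rewrite /delta; case: eqVneq => // _; have := prime_gt1 pp; case: (p) => [|[]].
Qed.

(** For m < n the difference is a unit times gamma^((n - m) delta) - 1, to which lifting the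
    exponent applies. In the exceptional case p = 2, k0 = 1 the extra factor gamma^-1 is a unit as
    well. *)
Lemma vp_wcoord_sub (m n : int) : m != n ->
  v (w n - w m) = (weight_dist (m - n))%:R%:E.
Proof.
wlog mn : m n / m < n => [H mn|_].
  have [mn'|nm|/eqP] := ltgtP m n; [exact: H| |by rewrite (negbTE mn)].
  rewrite -(vpN _ hC) opprB H// 1?eq_sym// /weight_dist.
  by rewrite -(opprB n m) abszN.
have vg := vp_gamma.
have g0 : gamma != 0 by exact: (vp_unit_neq0 hC).
have E : v (gamma ^ kn p k0 n - gamma ^ kn p k0 m) = (weight_dist (m - n))%:R%:E.
  have -> : kn p k0 n = kn p k0 m + (`|n - m| * delta p)%N%:Z.
    by rewrite PoszM gez0_abs ?subr_ge0 ?ltW// /kn; ring.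
  rewrite expfzDr// -{2}[gamma ^ kn p k0 m]mulr1 -mulrBr (vpM hC).
  have -> : v (gamma ^ kn p k0 m) = 0%E.
    rewrite /exprz; case: (kn _ _ _) => k; first exact: (vpX_unit _ hC).
    by apply: (vpV_unit hC); exact: (vpX_unit _ hC).
  have nm0 : (0 < `|n - m|)%N by rewrite absz_gt0 subr_eq0 gt_eqF.
  rewrite add0e [LHS](@vp_X_sub1 _ v2p%:R) ?vp_gamma_sub1//; last first.
    by rewrite muln_gt0 nm0 delta_gt0.
  rewrite lognM ?delta_gt0// /weight_dist -(opprB n m) abszN.
  by rewrite -natrD addnA addnAC.
rewrite /wcoord /int_weight -E; case: ifP => _; last by congr v; ring.
rewrite opprB addrA subrK -mulrBl (vpM hC) (vpV_unit hC vg).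
by rewrite adde0.
Qed.

(** * Coefficients of the ghost series at integer weights *)

Variables (d dnew : int -> int).

Lemma ghost_series_prod (n : int) (i : nat) (r : seq int) : uniq r ->
  (forall m, m \notin r -> ghost_mult d dnew i m = 0%N) ->
  ghost_series p k0 gamma d dnew (int_weight (kn p k0 n)) i =
  \prod_(m <- r) (w n - w m) ^+ ghost_mult d dnew i m.
Proof.
move=> ur hr; rewrite /ghost_series /ghost_poly.
rewrite -(@fsbig_widen _ _ _ _ [set` r]) //; last first.
  by move=> m /= [_ /negP mr]; rewrite /= hr// expr0.
rewrite -fsbig_seq// horner_prod; apply: eq_bigr => m _.
by rewrite !hornerE.
Qed.

Lemma vp_ghost_series (n : int) (i : nat) (r : seq int) : uniq r ->
  (forall m, m \notin r -> ghost_mult d dnew i m = 0%N) ->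
  v (ghost_series p k0 gamma d dnew (int_weight (kn p k0 n)) i) =
  if ghost_mult d dnew i n == 0%N
  then (\sum_(m <- r) ghost_mult d dnew i m * weight_dist (m - n))%N%:R%:E
  else +oo%E.
Proof.
move=> ur hr; rewrite (ghost_series_prod _ ur hr).
case: ifPn => [/eqP n0|n0]; last first.
  have nr : n \in r by apply: contraNT n0 => /hr ->.
  by rewrite (bigD1_seq n)//= subrr expr0n (negbTE n0) mul0r (vp0 hC).
elim: (r) => [|m s IH]; first by rewrite !big_nil (vp1 hC).
rewrite !big_cons (vpM hC) IH natrD EFinD; congr (_ + _)%E.
(* At m = n the multiplicity is 0, which hides the junk value of [weight_dist]. *)
have [->|mn] := eqVneq m n; first by rewrite n0 expr0 (vp1 hC).
elim: (ghost_mult d dnew i m) => [|k IHk]; first by rewrite expr0 (vp1 hC).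
by rewrite exprS (vpM hC) IHk vp_wcoord_sub// mulSn natrD EFinD.
Qed.

End Valuations.

(** * Average of the p-adic valuation over an interval *)

Section Legendre.
Variables (R : realType) (p : nat).
Hypothesis pp : prime p.
Let p1 : (1 < p)%N := prime_gt1 pp.

(** Legendre's sum of the floors of m / p^k, shifted by one; the terms that the sum for m / p lacks
    are 0. *)
Lemma logn_fact_rec m : logn p m`! = (m %/ p + logn p (m %/ p)`!)%N.
Proof.
case: m => [|m]; first by rewrite div0n.
rewrite (logn_fact _ pp) big_nat_recl// expn1; congr addn.
rewrite (logn_fact _ pp) [in RHS]big_add1 /=.
have mp : (m.+1 %/ p <= m)%N by rewrite -ltnS ltn_Pdiv.
rewrite big_add1 /= (big_cat_nat (leq0n _) mp)//= [X in (_ + X)%N]big1_seq ?addn0.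
  by apply: eq_bigr => k _; rewrite -divnMA -expnS.
move=> k; rewrite mem_index_iota => /and3P[_ mk _].
by rewrite expnS divnMA divn_small//; apply: (leq_ltn_trans mk); exact: ltn_trans (ltn_expl k.+1 p1).
Qed.

(** With a the quotient by p, induction gives (p - 1)(a + v(a!)) <= (p - 1)a + a = pa. *)
Lemma logn_fact_le m : (p.-1 * logn p m`! <= m)%N.
Proof.
elim/ltn_ind: m => -[|m] IH; first by rewrite logn1 muln0.
rewrite logn_fact_rec; have := IH (m.+1 %/ p)%N (ltn_Pdiv p1 (ltn0Sn m)).
have := divn_eq m.+1 p; move: p1; case: (p) => // q _.
set a := (_ %/ _)%N; move=> /= E H; rewrite mulnDr.
apply: (@leq_trans (q * a + a)); first by rewrite leq_add2l.
by rewrite E mulnS [(q * a)%N]mulnC [(_ + a)%N]addnC leq_addr.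
Qed.

Let ln2_gt0 : 0 < ln 2 :> R. Proof. by rewrite ln_gt0// ltr1n. Qed.
Let q0 : 0 < p.-1%:R :> R. Proof. by rewrite ltr0n; case: (p) p1 => [|[]]. Qed.

Lemma ler_ln_nat (m n : nat) : (0 < m)%N -> (m <= n)%N -> ln m%:R <= ln n%:R :> R.
Proof.
move=> m0 mn; rewrite ler_ln ?posrE ?ltr0n ?ler_nat//; exact: leq_trans mn.
Qed.

(** The left side is the base p digit sum. A nonzero digit r costs at most p - 1, paid for by the
    growth of ln, since 2(a + 1) <= ap + r + 1; a zero digit costs nothing. *)
Lemma logn_fact_ge m :
  m%:R - p.-1%:R * (logn p m`!)%:R <= p.-1%:R / ln 2 * ln m.+1%:R :> R.
Proof.
elim/ltn_ind: m => -[|m] IH; first by rewrite logn1 mulr0 subr0 ln1 mulr0.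
rewrite logn_fact_rec; have := IH (m.+1 %/ p)%N (ltn_Pdiv p1 (ltn0Sn m)).
have Em := divn_eq m.+1 p; have rp := ltn_pmod m.+1 (prime_gt0 pp).
move: Em rp; set a := (_ %/ _)%N; set r := (_ %% _)%N => Em rp.
have pE : p = p.-1.+1 by rewrite prednK// prime_gt0.
have -> : m.+1%:R = a%:R * p.-1%:R + a%:R + r%:R :> R.
  by rewrite Em {1}pE mulnS natrD natrD natrM; ring.
have -> : m.+2 = (a * p + r).+1 by rewrite -Em.
rewrite natrD => H.
suff : r%:R + p.-1%:R / ln 2 * ln a.+1%:R <=
    p.-1%:R / ln 2 * ln (a * p + r).+1%:R :> R by lra.
have [r0|r0] := posnP r.
  rewrite r0 add0r addn0 ler_wpM2l ?divr_ge0 ?(ltW q0) ?(ltW ln2_gt0)//.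
  by apply: ler_ln_nat => //; rewrite ltnS leq_pmulr// prime_gt0.
have rq : r%:R <= p.-1%:R :> R by rewrite ler_nat -ltnS -pE.
apply: le_trans (_ : p.-1%:R / ln 2 * (ln 2 + ln a.+1%:R) <= _).
  by rewrite mulrDr mulfVK ?gt_eqF// lerD2r.
rewrite ler_wpM2l ?divr_ge0 ?(ltW q0) ?(ltW ln2_gt0)// -lnM ?posrE ?ltr0n//.
rewrite -natrM; apply: ler_ln_nat; first by rewrite muln_gt0.
have : (a * 2 <= a * p)%N by rewrite leq_mul2l p1 orbT.
lia.
Qed.

Lemma logn_fact_bounds m :
  (m%:R / p.-1%:R - ln m.+1%:R / ln 2 <= (logn p m`!)%:R :> R) &&
  ((logn p m`!)%:R <= m%:R / p.-1%:R :> R).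
Proof.
apply/andP; split; last first.
  by rewrite ler_pdivlMr// mulrC -natrM ler_nat logn_fact_le.
rewrite -(ler_pM2l q0).
have -> : p.-1%:R * (m%:R / p.-1%:R - ln m.+1%:R / ln 2) =
    m%:R - p.-1%:R / ln 2 * ln m.+1%:R :> R.
  by field; rewrite !gt_eqF.
by have := logn_fact_ge m; lra.
Qed.

(** The distances z, ..., z - x + 1 have product z! / (z - x)!. *)
Lemma sum_logn_dist_lt x z : (x <= z)%N ->
  (\sum_(0 <= l < x) logn p `|l%:Z - z%:Z| + logn p (z - x)`! = logn p z`!)%N.
Proof.
elim: x => [|x IH] xz; first by rewrite big_geq// subn0.
rewrite -(IH (ltnW xz)) big_nat_recr//= -addnA; congr addn.
have -> : (z - x)%N = (z - x.+1).+1 by rewrite -subSn.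
rewrite factS lognM ?fact_gt0//; congr (logn _ _ + _)%N; lia.
Qed.

(** Here z lies in the range. Its own term is [logn p 0 = 0], and the distances on its two sides
    have products z! and y!. *)
Lemma sum_logn_dist_gt y z :
  (\sum_(0 <= l < (z + y).+1) logn p `|l%:Z - z%:Z| = logn p z`! + logn p y`!)%N.
Proof.
elim: y => [|y IH].
  rewrite addn0 big_nat_recr//= subrr logn0 addn0 logn1 addn0.
  by rewrite -(sum_logn_dist_lt (leqnn z)) subnn logn1 addn0.
rewrite addnS big_nat_recr//= IH -addnA; congr addn.
by rewrite factS lognM ?fact_gt0// addnC; congr (logn _ _ + _)%N; lia.
Qed.

(** The factor 3: two factorials err by at most one logarithm each, and when z lies in the range its
    zero term costs 1/(p - 1) <= 1. *)
Lemma sum_logn_dist0 x z :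
  `|(\sum_(0 <= l < x) logn p `|l%:Z - z%:Z|)%N%:R - x%:R / p.-1%:R| <=
  3 / ln 2 * ln (x + z).+2%:R :> R.
Proof.
pose S : R := (\sum_(0 <= l < x) logn p `|l%:Z - z%:Z|)%N%:R.
rewrite -[leLHS]/(`|S - x%:R / p.-1%:R|).
have iq : p.-1%:R^-1 <= 1 :> R by rewrite invf_le1// ler1n -ltnS prednK ?prime_gt0.
have L2 : 1 <= ln (x + z).+2%:R / ln 2 :> R.
  by rewrite ler_pdivlMr// mul1r; apply: (@ler_ln_nat 2).
have Lm m : (m <= x + z)%N ->
    (0 <= ln m.+1%:R / ln 2 :> R) &&
    (ln m.+1%:R / ln 2 <= ln (x + z).+2%:R / ln 2 :> R).
  move=> mxz; rewrite divr_ge0 ?ln_ge0 ?ler1n ?(ltW ln2_gt0)//=.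
  by rewrite ler_pM2r ?invr_gt0//; apply: ler_ln_nat => //; rewrite ltnS ltnW.
rewrite mulrAC -mulrA ler_norml.
move: Lm L2; set L := ln _ / ln 2 => Lm L2.
have /andP[z1 z2] := logn_fact_bounds z.
have /andP[Lz0 Lz] := Lm z (leq_addl x z).
have [xz|zx] := leqP x z.
  have : S + (logn p (z - x)`!)%:R = (logn p z`!)%:R.
    by rewrite -(sum_logn_dist_lt xz) natrD.
  have /andP[] := logn_fact_bounds (z - x).
  have /andP[] := Lm (z - x)%N (leq_trans (leq_subr _ _) (leq_addl x z)).
  rewrite [(z - x)%:R]natrB// mulrBl.
  move: z1 z2; set A := _%:R; set B := _%:R; set D := _ / _; set E := _ / _.
  by move=> *; apply/andP; split; lra.
set y := (x - z.+1)%N; have xE : x = (z + y).+1 by rewrite /y; lia.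
have -> : S = (logn p z`!)%:R + (logn p y`!)%:R.
  by rewrite /S {1}xE sum_logn_dist_gt natrD.
have /andP[] := logn_fact_bounds y.
have /andP[] := Lm y (leq_trans (leq_subr _ _) (leq_addr z x)).
have -> : x%:R = z%:R + y%:R + 1 :> R by rewrite {1}xE -natr1 natrD.
rewrite !mulrDl mul1r.
move: z1 z2; set A := _%:R; set B := _%:R; set D := _ / _; set E := _ / _.
have : 0 < p.-1%:R^-1 :> R by rewrite invr_gt0.
by move=> *; apply/andP; split; lra.
Qed.

(** The mean of [weight_dist], as its constant part plus the mean 1/(p - 1) of v_p; it is the first
    factor of D. *)
Lemma weight_dist_mean :
  (v2p p + logn p (delta p))%N%:R + p.-1%:R^-1 = (qq p)%:R / (p%:R - 1) :> R.
Proof.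
have -> : p%:R - 1 = p.-1%:R :> R.
  by rewrite -[in LHS](prednK (prime_gt0 pp)) -natr1 addrK.
rewrite /v2p /qq /delta; case: eqVneq => [->|p2].
  by rewrite /= logn_prime// eqxx invr1 mulr1 natr1.
rewrite logn_coprime ?addn0.
  have -> : p%:R = p.-1%:R + 1 :> R by rewrite natr1 prednK ?prime_gt0.
  by field; rewrite gt_eqF.
rewrite prime_coprime// gtnNdvd//; first by case: (p) p1 => [|[]].
by rewrite ltn_predL prime_gt0.
Qed.

Lemma sum_weight_dist x y z : (x <= y)%N ->
  `|(\sum_(x <= l < y) weight_dist p (l%:Z - z%:Z))%N%:R -
    (qq p)%:R / (p%:R - 1) * (y%:R - x%:R)| <= 6 / ln 2 * ln (y + z).+2%:R :> R.
Proof.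
move=> xy.
pose S : R := (\sum_(x <= l < y) weight_dist p (l%:Z - z%:Z))%N%:R.
rewrite -[leLHS]/(`|S - (qq p)%:R / (p%:R - 1) * (y%:R - x%:R)|).
pose V k : R := (\sum_(0 <= l < k) logn p `|l%:Z - z%:Z|)%N%:R.
have -> : S = (y%:R - x%:R) * (v2p p + logn p (delta p))%N%:R + (V y - V x).
  rewrite /S /weight_dist big_split /= sum_nat_const_nat natrD natrM natrB//.
  by rewrite /V (big_cat_nat (leq0n x) xy) /= natrD; ring.
set T : R := ln (y + z).+2%:R / ln 2.
have Vk k : (k <= y)%N -> `|V k - k%:R / p.-1%:R| <= 3 * T.
  move=> ky; apply: le_trans (sum_logn_dist0 k z) _.
  rewrite -mulrA ler_wpM2l// mulrC ler_wpM2r ?invr_ge0 ?(ltW ln2_gt0)//.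
  by apply: ler_ln_nat => //; rewrite !ltnS leq_add2r.
rewrite (_ : 6 / _ * _ = 6 * T); last by rewrite /T; ring.
rewrite -weight_dist_mean.
have := Vk x xy; have := Vk y (leqnn y).
rewrite !ler_norml => /andP[H1 H2] /andP[H3 H4].
by apply/andP; split; lra.
Qed.

End Legendre.

(** * Increments of the ghost heights *)

Section Thresholds.
Variable R : realType.

(** The finitely many values before the asymptotic range are absorbed through the sum of their
    errors, and the shift by [m0] costs |a m0|. *)
Lemma asymp_linear_nat (f : int -> int) (a : R) (m0 : nat) :
  (exists K : R, exists N : int, forall n, N <= n ->
     `|(f n)%:~R - a * n%:~R| <= K) ->
  exists2 K : R, 0 <= K &
    forall l : nat, `|(f (l%:Z - m0%:Z))%:~R - a * l%:R| <= K.
Proof.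
move=> [K [N hK]].
pose g (l : nat) : R := `|(f (l%:Z - m0%:Z))%:~R - a * l%:R|.
have sg0 L : 0 <= \sum_(l < L) g l by apply: sumr_ge0 => l _; exact: normr_ge0.
pose L := (`|N| + m0)%N.
exists (`|K| + `|a * m0%:R| + \sum_(l < L) g l) => [|l].
  by rewrite addr_ge0// addr_ge0.
have [lL|Ll] := ltnP l L.
  apply: (@le_trans _ _ (\sum_(l < L) g l)); last by rewrite lerDr addr_ge0.
  rewrite (bigD1 (Ordinal lL)) //= lerDl; apply: sumr_ge0 => k _.
  exact: normr_ge0.
have Nl : N <= l%:Z - m0%:Z by move: Ll; rewrite /L; lia.
have := hK _ Nl; rewrite rmorphB /= => H.
have -> : (f (l%:Z - m0%:Z))%:~R - a * l%:R =
    (f (l%:Z - m0%:Z))%:~R - a * (l%:~R - m0%:~R) - a * m0%:R.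
  by rewrite -!pmulrn; ring.
apply: (le_trans (ler_normB _ _)).
have := sg0 L; have := ler_norm K; lra.
Qed.

(** [T] is the least l with x <= f l. The inequalities f T >= x and f (T - 1) < x locate it by
    linear growth; the step from T - 1 to T gives the summand 1, and [0 <= x] settles T = 0. *)
Lemma threshold (f : nat -> int) (a K : R) (x : int) :
  0 < a -> 0 <= K -> (forall l, `|(f l)%:~R - a * l%:R| <= K) ->
  {homo f : k l / (k <= l)%N >-> k <= l} -> 0 <= x ->
  exists2 T : nat, forall l, (l < T)%N = (f l < x) &
    `|T%:R - x%:~R / a| <= K / a + 1.
Proof.
move=> a0 K0 fK fhomo x0.
have ex : exists l, x <= f l.
  exists (Num.truncn ((x%:~R + K) / a)).+1.
  rewrite -(ler_int R).
  have := truncnS_gt ((x%:~R + K) / a); rewrite ltr_pdivrMr// mulrC.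
  have := fK (Num.truncn ((x%:~R + K) / a)).+1.
  by rewrite ler_norml => /andP[]; lra.
pose T := ex_minn ex.
have [Tx Tmin] : x <= f T /\ (forall l, x <= f l -> (T <= l)%N).
  by rewrite /T; case: ex_minnP.
have TE l : (l < T)%N = (f l < x).
  rewrite ltnNge [RHS]ltNge; congr (~~ _); apply/idP/idP => [Tl|/Tmin//].
  by apply: (le_trans Tx); apply: fhomo.
exists T => //.
have aV : a * (x%:~R / a) = x%:~R by rewrite mulrCA mulfV ?gt_eqF// mulr1.
have aK : a * (K / a) = K by rewrite mulrCA mulfV ?gt_eqF// mulr1.
rewrite ler_norml; apply/andP; split.
  rewrite -(ler_pM2l a0).
  have := fK T; rewrite ler_norml => /andP[_].
  by move: Tx; rewrite -(ler_int R); lra.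
rewrite -(ler_pM2l a0).
case: (T) TE => [_|t TE].
  have : 0 <= x%:~R :> R by rewrite ler0z.
  lra.
have := TE t; rewrite ltnSn => /esym; rewrite -(ltr_int R).
have := fK t; rewrite ler_norml => /andP[? _].
rewrite -natr1; lra.
Qed.

(** The additive constant ln(c + 1) is absorbed because ln m >= ln 2; c + 1 in place of c keeps it
    nonnegative. *)
Lemma ln_affine_bound (c : R) : 0 <= c ->
  exists2 K : R, 0 < K & forall (y : R) (m : nat), 0 < y -> (2 <= m)%N ->
    y <= c * m%:R -> ln y <= K * ln m%:R.
Proof.
move=> c0; have l2 : 0 < ln 2 :> R by rewrite ln_gt0// ltr1n.
have lc : 0 <= ln (c + 1) by rewrite ln_ge0// lerDr.
exists (ln (c + 1) / ln 2 + 1) => [|y m y0 m2 ym].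
  by rewrite ltr_wpDl// divr_ge0// ltW.
have m0 : 0 < m%:R :> R by rewrite ltr0n ltnW.
have c1 : 0 < c + 1 by lra.
have lm : ln 2 <= ln m%:R :> R by apply: (@ler_ln_nat R 2).
apply: (@le_trans _ _ (ln ((c + 1) * m%:R))).
  rewrite ler_ln ?posrE ?mulr_gt0//; lra.
rewrite lnM ?posrE// mulrDl mul1r lerD2r mulrAC ler_pdivlMr//.
by rewrite ler_wpM2l.
Qed.

End Thresholds.

(** In i the multiplicity is a tent with feet d and d + dnew. Its top is flat when 2d + dnew = 2i +
    1, hence the two thresholds 2i + 1 and 2i + 2. *)
Lemma ghost_multS (d dnew : int -> int) (i : nat) (m : int) :
  (ghost_mult d dnew i.+1 m +
     ((2 * d m + dnew m < (2 * i).+1%:Z)%R && ~~ (d m + dnew m < i.+1%:Z)%R) =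
   ghost_mult d dnew i m +
     ((d m < i.+1%:Z)%R && ~~ (2 * d m + dnew m < (2 * i).+2%:Z)%R))%N.
Proof.
rewrite /ghost_mult; set a := d m; set b := dnew m.
by do ! (case: ifP || case: ifPn); lia.
Qed.

Lemma sum_nat_indicator (F : nat -> nat) (a b N : nat) : (b <= N)%N ->
  (\sum_(0 <= l < N) ((l < b) && ~~ (l < a)) * F l = \sum_(a <= l < b) F l)%N.
Proof.
move=> bN; rewrite (big_nat_widen _ _ _ _ _ bN) (big_nat_widenl _ _ _ _ _ (leq0n a)).
rewrite [RHS]big_mkcond /=; apply: eq_bigr => l _.
by rewrite -leqNgt; case: (l < b)%N; case: (a <= l)%N; rewrite /= ?mul1n ?mul0n.
Qed.

(** * Sums of weight distances between approximate end points *)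

Section WeightSums.
Variables (R : realType) (p : nat).
Hypothesis pp : prime p.
Let c1 : R := (qq p)%:R / (p%:R - 1).

Lemma c1_gt0 : 0 < c1.
Proof.
rewrite divr_gt0 ?subr_gt0 ?ltr1n ?prime_gt1//.
by rewrite ltr0n /qq; case: ifP => // _; exact: prime_gt0.
Qed.

Lemma sum_weight_dist_near (a b z : nat) (al be ka : R) :
  al <= be -> `|a%:R - al| <= ka -> `|b%:R - be| <= ka ->
  `|(\sum_(a <= l < b) weight_dist p (l%:Z - z%:Z))%N%:R - c1 * (be - al)| <=
  6 / ln 2 * ln (b + z).+2%:R + 2 * c1 * ka :> R.
Proof.
move=> ab; rewrite !ler_norml => /andP[a1 a2] /andP[b1 b2].
have c0 := c1_gt0.
have l2 : 0 < ln 2 :> R by rewrite ln_gt0// ltr1n.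
have lb : 0 <= 6 / ln 2 * ln (b + z).+2%:R :> R.
  by rewrite mulr_ge0 ?divr_ge0 ?(ltW l2)// ln_ge0// ler1n.
have [leab|ltba] := leqP a b.
  have := sum_weight_dist R pp z leab; rewrite -/c1 ler_norml => /andP[].
  set s := _%N%:R; set t := _ * ln _.
  have : c1 * (b%:R - a%:R - (be - al)) <= c1 * (2 * ka) by rewrite ler_pM2l//; lra.
  have : c1 * (- (2 * ka)) <= c1 * (b%:R - a%:R - (be - al)) by rewrite ler_pM2l//; lra.
  by move=> *; apply/andP; split; lra.
(* If b < a, then be - al <= 2 ka and the main term is itself within the error. *)
rewrite big_geq ?(ltnW ltba)//.
have : b%:R <= a%:R :> R by rewrite ler_nat ltnW.
move=> ba.
have : c1 * (be - al) <= c1 * (2 * ka) by rewrite ler_pM2l//; lra.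
have : 0 <= c1 * (be - al) by rewrite mulr_ge0 ?(ltW c0)//; lra.
move: lb; set t := _ * ln _.
by move=> *; apply/andP; split; lra.
Qed.

End WeightSums.

(** * Heights of the ghost coefficients *)

Section GhostHeights.
Variables (R : realType) (C : closedFieldType) (v : C -> \bar R) (p : nat).
Hypotheses (hC : is_Cp v p) (pp : prime p).
Variables (k0 : nat) (gamma : C).
Hypothesis hgamma : top_generator v p gamma.
Variables (d dnew : int -> int) (A B : R).
Hypotheses (hG : hypG d dnew) (hND : hypND d dnew) (hLG : hypLG d dnew A B).

Let c1 : R := (qq p)%:R / (p%:R - 1).
Let D : R := c1 * (B ^+ 2 / (A * (A + B) * (2 * A + B))).

(** Meant for the pairs (1, 0), (1, 1) and (2, 1), which give the three functions of [hypND]. *)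
Lemma asymp_linear_comb (a b : int) :
  exists K : R, exists N : int, forall n, N <= n ->
    `|(a * d n + b * dnew n)%:~R - (a%:~R * A + b%:~R * B) * n%:~R| <= K.
Proof.
have [_ _ [K1 [N1 h1]] [K2 [N2 h2]]] := hLG.
exists (`|a%:~R| * K1 + `|b%:~R| * K2), (Num.max N1 N2) => n.
rewrite ge_max => /andP[/h1 n1 /h2 n2].
have -> : (a * d n + b * dnew n)%:~R - (a%:~R * A + b%:~R * B) * n%:~R =
    a%:~R * ((d n)%:~R - A * n%:~R) + b%:~R * ((dnew n)%:~R - B * n%:~R) :> R.
  by rewrite rmorphD !rmorphM /=; ring.
apply: le_trans (ler_normD _ _) _; rewrite !normrM.
by rewrite lerD// ler_wpM2l.
Qed.

(* The weights k_m with m < - m0 contribute to no g_i with i >= 0, so that the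
   roots can be indexed by the l : nat with m = l - m0. *)
Lemma ghost_mult_below : exists m0 : nat, forall (i : nat) (m : int),
  m < - m0%:Z -> ghost_mult d dnew i m = 0%N.
Proof.
have [_ /(_ 0)[N hN]] := hG.
exists `|N|%N => i m mN; rewrite /ghost_mult.
have e0 : d m + dnew m <= 0 by apply: hN; lia.
by case: ifP => // /andP[_]; lia.
Qed.

(* [h n i] is the valuation of g_i(w_(k_n)) with the junk value of weight_dist
   at m = n, which is harmless when k_n has multiplicity 0 in g_i. *)
Lemma ghost_heights : exists h : nat -> nat -> R, exists2 K : R, 0 < K &
  [/\ forall n i : nat,
        v (ghost_series p k0 gamma d dnew (int_weight (kn p k0 n)) i) =
        if ghost_mult d dnew i n == 0%N then (h n i)%:E else +oo%E,
      forall n i, 0 <= h n i &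
      forall n i, `|h n i.+1 - h n i - D * i.+1%:R| <=
        K * ln (n + i.+1).+2%:R].
Proof.
have [A0 B0 _ _] := hLG; have [dhomo ehomo phomo] := hND.
have [m0 below] := ghost_mult_below.
pose sh (l : nat) : int := l%:Z - m0%:Z.
have shhomo (k l : nat) : (k <= l)%N -> sh k <= sh l by rewrite /sh; lia.
have sh_inj : injective sh by move=> k l; rewrite /sh; lia.
have shK (m : int) : - m0%:Z <= m -> sh (absz (m + m0%:Z)) = m by rewrite /sh; lia.
have [Kd Kd0 dK] := asymp_linear_nat m0 (asymp_linear_comb 1 0).
have [Ke Ke0 eK] := asymp_linear_nat m0 (asymp_linear_comb 1 1).
have [Kp Kp0 pK] := asymp_linear_nat m0 (asymp_linear_comb 2 1).
have AB0 : 0 < A + B by lra.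
have AB20 : 0 < 2 * A + B by lra.
have Td (x : int) : 0 <= x -> exists2 T : nat,
    forall l, (l < T)%N = (d (sh l) < x) & `|T%:R - x%:~R / A| <= Kd / A + 1.
  apply: threshold => //.
    by move=> l; have := dK l; rewrite !(mul1r, mul0r, addr0).
  by move=> k l kl; exact/dhomo/shhomo.
have Te (x : int) : 0 <= x -> exists2 T : nat,
    forall l, (l < T)%N = (d (sh l) + dnew (sh l) < x) &
    `|T%:R - x%:~R / (A + B)| <= Ke / (A + B) + 1.
  apply: threshold => //.
    by move=> l; have := eK l; rewrite !(mul1r, mul0r, addr0).
  by move=> k l kl; exact/ehomo/shhomo.
have Tp (x : int) : 0 <= x -> exists2 T : nat,
    forall l, (l < T)%N = (2 * d (sh l) + dnew (sh l) < x) &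
    `|T%:R - x%:~R / (2 * A + B)| <= Kp / (2 * A + B) + 1.
  apply: threshold => //.
    by move=> l; have := pK l; rewrite !(mul1r, mul0r, addr0).
  by move=> k l kl; exact/phomo/shhomo.
have /choice[N HN] : forall i : nat, exists N : nat,
    forall l, (N <= l)%N -> ghost_mult d dnew i (sh l) = 0%N.
  move=> i; have [//|T TE _] := Td i; exists T => l.
  rewrite leqNgt TE -leNgt /ghost_mult => il.
  by case: ifP => // /andP[]; lia.
pose W (n l : nat) : nat := weight_dist p (sh l - n%:Z).
(* The value is the same for all M >= N i, so the sums for i and i + 1 can be taken over a common
   range. *)
pose H (n i M : nat) : nat := (\sum_(0 <= l < M) ghost_mult d dnew i (sh l) * W n l)%N.
have HM n i M : (N i <= M)%N -> H n i M = H n i (N i).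
  move=> NM; rewrite /H (big_cat_nat (leq0n _) NM) /=.
  rewrite [X in (_ + X)%N]big1_seq ?addn0// => l.
  by rewrite mem_index_iota => /and3P[_ Nl _]; rewrite HN.
(* One error for all end points; with x = i + 1, the last summand pays for replacing 2x - 1 by 2x in
   the threshold [tp]. *)
pose ka : R := Kd / A + 1 + (Ke / (A + B) + 1) + (Kp / (2 * A + B) + 1)
  + (2 * A + B)^-1.
have KdA : 0 <= Kd / A by rewrite divr_ge0// ltW.
have KeA : 0 <= Ke / (A + B) by rewrite divr_ge0// ltW.
have KpA : 0 <= Kp / (2 * A + B) by rewrite divr_ge0// ltW.
have iAB : 0 <= (2 * A + B)^-1 by rewrite invr_ge0 ltW.
have ka0 : 0 <= ka by rewrite /ka; lra.
have iA0 : 0 < A^-1 by rewrite invr_gt0.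
have l2 : 0 < ln 2 :> R by rewrite ln_gt0// ltr1n.
have c0 : 0 < c1 by exact: c1_gt0.
(* Chosen so that b + (m0 + n) + 2 <= c (n + i + 3) for every end point b <= (i + 1)/A + ka. *)
pose c : R := A^-1 + ka + m0%:R + 1.
have cge0 : 0 <= c by rewrite /c; have : 0 <= m0%:R :> R by []; lra.
have [K1 K10 HK1] := ln_affine_bound cge0.
(* Twice the error in [near], its constant part turned into a logarithm by ln 2 <= ln(n + i + 3). *)
pose K : R := 12 / ln 2 * K1 + 4 * c1 * ka / ln 2.
exists (fun n i => (H n i (N i))%:R), K.
  have : 0 < 12 / ln 2 * K1 by rewrite !mulr_gt0 ?invr_gt0.
  have : 0 <= 4 * c1 * ka / ln 2 by rewrite divr_ge0 ?(ltW l2)// mulr_ge0// mulr_ge0// ltW.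
  by rewrite /K; lra.
split=> // [n i|n i].
  have -> := @vp_ghost_series _ _ _ _ hC pp k0 _ hgamma d dnew n i
    [seq sh l | l <- iota 0 (N i)].
  - by case: ifP => // _; rewrite /H big_map /index_iota subn0.
  - by rewrite map_inj_uniq ?iota_uniq.
  - move=> m mr; have [mm|mm] := ltP m (- m0%:Z); first exact: below.
    rewrite -(shK m mm); apply: HN; rewrite leqNgt; apply: contra mr => mN.
    by rewrite -(shK m mm) map_f// mem_iota.
(* From i to i + 1 the multiplicity rises by 1 for tq <= l < td and falls by 1 for te <= l < tp. *)
have [//|td tdE tdB] := Td i.+1; have [//|te teE teB] := Te i.+1.
have [//|tp tpE tpB] := Tp (2 * i).+1%N; have [//|tq tqE tqB] := Tp (2 * i).+2%N.
pose M := maxn (maxn (N i) (N i.+1)) (maxn td tp).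
have [M1 M2 M3 M4] : [/\ (N i <= M)%N, (N i.+1 <= M)%N, (td <= M)%N & (tp <= M)%N].
  by rewrite /M !leq_max !leqnn ?orbT.
have key : (H n i.+1 M + \sum_(te <= l < tp) W n l =
            H n i M + \sum_(tq <= l < td) W n l)%N.
  rewrite -(sum_nat_indicator _ _ M4) -(sum_nat_indicator _ _ M3) /H -!big_split /=.
  apply: eq_bigr => l _; rewrite -!mulnDl; congr (_ * _)%N.
  by rewrite tdE teE tpE tqE; exact: ghost_multS.
rewrite -(HM n i M)// -(HM n i.+1 M)//.
have /eqP := congr1 (fun k : nat => k%:R : R) key; rewrite !natrD => /eqP keyR.
have near (a b : nat) (al be : R) : al <= be ->
    `|a%:R - al| <= ka -> `|b%:R - be| <= ka -> b%:R <= i.+1%:R / A + ka ->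
    `|(\sum_(a <= l < b) W n l)%N%:R - c1 * (be - al)| <=
    6 / ln 2 * (K1 * ln (n + i.+1).+2%:R) + 2 * c1 * ka.
  move=> albe a1 b1 bb.
  have -> : (\sum_(a <= l < b) W n l = \sum_(a <= l < b) weight_dist p (l%:Z - (m0 + n)%N%:Z))%N.
    by apply: eq_bigr => l _; rewrite /W /sh PoszD opprD addrA.
  apply: le_trans (sum_weight_dist_near pp (m0 + n) albe a1 b1) _.
  rewrite lerD2r ler_wpM2l ?divr_ge0 ?(ltW l2)//.
  apply: HK1 => //; rewrite ?ltr0n//.
  rewrite -[(n + _).+2]addn2 -[(b + _).+2]addn2 !natrD /c.
  have iR : 1 <= i.+1%:R :> R by rewrite ler1n.
  have nR : 0 <= n%:R :> R by [].
  have mR : 0 <= m0%:R :> R by [].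
  move: bb iR; set x := i.+1%:R => bb iR; clear -bb iR nR mR iA0 ka0.
  have : 0 <= A^-1 * (n%:R + 2) by rewrite mulr_ge0// ?(ltW iA0)//; lra.
  have : 0 <= ka * (n%:R + (x - 1) + 2) by rewrite mulr_ge0//; lra.
  have : 0 <= m0%:R * (n%:R + (x - 1) + 2) by rewrite mulr_ge0//; lra.
  lra.
pose x : R := i.+1%:R.
have x0 : 0 <= x by [].
(* The origin of D: the length of the rising interval minus that of the falling one, with ideal end
   points x/A, 2x/(2A + B) and x/(A + B). *)
have DE : D * x = c1 * (x / A - 2 * x / (2 * A + B)) -
    c1 * (2 * x / (2 * A + B) - x / (A + B)).
  by rewrite /D; field; rewrite !gt_eqF.
have xA : 2 * x / (2 * A + B) <= x / A.
  rewrite ler_pdivrMr//.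
  have -> : x / A * (2 * A + B) = 2 * x + x * B / A by field; rewrite gt_eqF.
  by rewrite lerDl divr_ge0 ?mulr_ge0 ?(ltW B0) ?(ltW A0).
have xAB : x / (A + B) <= 2 * x / (2 * A + B).
  rewrite ler_pdivrMr//.
  have -> : 2 * x / (2 * A + B) * (A + B) = x + x * B / (2 * A + B).
    by field; rewrite gt_eqF.
  by rewrite lerDl divr_ge0 ?mulr_ge0 ?(ltW B0) ?(ltW AB20).
have tqx : (2 * i).+2%:~R = 2 * x :> R.
  by rewrite -pmulrn /x -[i.+1%:R]natr1 -addn2 natrD natrM; ring.
have tpx : (2 * i).+1%:~R = 2 * x - 1 :> R.
  by rewrite -tqx -!pmulrn -[in RHS]natr1 addrK.
move: tdB teB tpB tqB; rewrite tqx tpx mulrBl mul1r -!pmulrn -/x !ler_norml.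
move=> /andP[td1 td2] /andP[te1 te2] /andP[tp1 tp2] /andP[tq1 tq2].
have [te_ka tp_ka tp_ub] : [/\ `|te%:R - x / (A + B)| <= ka,
    `|tp%:R - 2 * x / (2 * A + B)| <= ka & tp%:R <= x / A + ka].
  rewrite !ler_norml /ka; clear -te1 te2 tp1 tp2 KdA KeA KpA iAB xA.
  by split; [apply/andP; split; lra..|lra].
have [tq_ka td_ka td_ub] : [/\ `|tq%:R - 2 * x / (2 * A + B)| <= ka,
    `|td%:R - x / A| <= ka & td%:R <= x / A + ka].
  rewrite !ler_norml /ka; clear -tq1 tq2 td1 td2 KdA KeA KpA iAB.
  by split; [apply/andP; split; lra..|lra].
have := near tq td _ _ xA tq_ka td_ka td_ub.
have := near te tp _ _ xAB te_ka tp_ka tp_ub.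
rewrite !ler_norml => /andP[S1 S1'] /andP[S2 S2']; rewrite -/x DE.
have L2 : ln 2 <= ln (n + i.+1).+2%:R :> R by apply: (@ler_ln_nat R 2).
have KL : 6 / ln 2 * (K1 * ln (n + i.+1).+2%:R) * 2 + 2 * c1 * ka * 2 <=
    K * ln (n + i.+1).+2%:R.
  have -> : K * ln (n + i.+1).+2%:R = 6 / ln 2 * (K1 * ln (n + i.+1).+2%:R) * 2 +
      4 * c1 * ka / ln 2 * ln (n + i.+1).+2%:R by rewrite /K; ring.
  rewrite lerD2l [leRHS]mulrAC ler_pdivlMr//.
  have -> : 2 * c1 * ka * 2 = 4 * c1 * ka by ring.
  by rewrite ler_wpM2l// mulr_ge0// mulr_ge0// ltW.
clear -S1 S1' S2 S2' KL keyR; move: S1 S1' S2 S2' KL keyR.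
set T1 := c1 * (_ - _); set T2 := c1 * (_ - _).
set L := _ * (K1 * _); set s1 := _%N%:R; set s2 := _%:R.
by move=> *; apply/andP; split; lra.
Qed.

End GhostHeights.

(** * Slopes *)

Section GapSlope.
Variables (R : realType) (C : closedFieldType) (v : C -> \bar R).
Variables (a : nat -> C) (S : pred nat) (h : nat -> R) (D K : R) (n : nat).
Hypothesis va : forall j, v (a j) = if S j then (h j)%:E else +oo%E.
Hypothesis h_ge0 : forall j, S j -> 0 <= h j.
Hypothesis hS : forall i,
  `|h i.+1 - h i - D * i.+1%:R| <= K * ln (n + i.+1).+2%:R.
Hypotheses (D0 : 0 < D) (K0 : 0 < K) (nK : 2 * K <= D * n%:R).

(** The sum of D l over j < l <= k is (k - j) D (k + j + 1)/2, and each increment errs by at most K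
    times the logarithm at k. *)
Lemma chord_estimate j k : (j <= k)%N ->
  `|h k - h j - (k%:R - j%:R) * (D / 2 * (k%:R + j%:R + 1))| <=
  (k%:R - j%:R) * (K * ln (n + k).+2%:R).
Proof.
elim: k => [|k IH].
  by rewrite leqn0 => /eqP ->; rewrite !subrr !mul0r subr0 normr0.
rewrite leq_eqVlt => /predU1P[->|jk].
  by rewrite !subrr !mul0r subr0 normr0.
have := IH jk; have := hS k.
have jkR : j%:R <= k%:R :> R by rewrite ler_nat.
have L : ln (n + k).+2%:R <= ln (n + k.+1).+2%:R :> R.
  by apply: ler_ln_nat => //; rewrite !ltnS leq_add2l.
have : (k%:R - j%:R) * (K * ln (n + k).+2%:R) <=
    (k%:R - j%:R) * (K * ln (n + k.+1).+2%:R).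
  by rewrite ler_wpM2l ?subr_ge0// ler_wpM2l// ltW.
rewrite -[k.+1%:R]natr1; set T := ln (n + k.+1).+2%:R; set U := ln _.
set x : R := k%:R; set y : R := j%:R.
rewrite !ler_norml => TU /andP[H1 H2] /andP[H3 H4].
by apply/andP; split; lra.
Qed.

(** The target is the slope of the ideal chord from [j0] to [k0]. Ideal chord slopes increase with
    either end point, so points outside the gap lie above this chord up to the logarithmic error. *)
Lemma slope_on_gap (i j0 k0 : nat) :
  (1 <= i)%N -> (j0 < i)%N -> (i <= k0)%N -> S j0 -> S k0 ->
  (forall j, S j -> (j <= j0)%N || (k0 <= j)%N) ->
  (`|NP_slope v a i - (D / 2 * (k0%:R + j0%:R + 1))%:E| <=
   (K * ln (n + k0).+2%:R)%:E)%E.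
Proof.
move=> i1 j0i ik0 Sj0 Sk0 gap.
set m := D / 2 * _; set e := K * _.
have jk0 : (j0 <= k0)%N by apply: leq_trans ik0; exact: ltnW.
suff /andP[] : ((m - e)%:E <= NP_slope v a i <= (m + e)%:E)%E.
  case: (NP_slope v a i) => // s; rewrite -EFinB !lee_fin ler_norml.
  by move=> ? ?; apply/andP; split; lra.
apply: (NP_slope_bounds va h_ge0 i1 j0i ik0 Sj0 Sk0).
  move=> k ik Sk; have {}ik : (k0 <= k)%N.
    by have /orP[|//] := gap k Sk; rewrite leqNgt (leq_trans j0i ik).
  have j0k : (j0 <= k)%N by exact: leq_trans ik.
  have := chord_estimate j0k; rewrite ler_norml => /andP[H _].
  have k0k : k0%:R <= k%:R :> R by rewrite ler_nat.
  have jkR : 0 <= k%:R - j0%:R :> R by rewrite subr_ge0 ler_nat.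
  suff : (m - e) * (k%:R - j0%:R) <=
      (k%:R - j0%:R) * (D / 2 * (k%:R + j0%:R + 1) - K * ln (n + k).+2%:R).
    lra.
  rewrite mulrC ler_wpM2l//.
  have kp (l : nat) : 0 < (n + l).+2%:R :> R by rewrite ltr0n.
  (* The tangent of ln at n + k0 + 2 bounds the growth of the error beyond [k0]; by [nK] its slope
     times K is at most D/2, the growth rate of the ideal chord slope. *)
  have : ln (n + k).+2%:R <= ln (n + k0).+2%:R + (k%:R - k0%:R) / (n + k0).+2%:R :> R.
    rewrite -lerBlDl -ln_div ?posrE//.
    have -> : (n + k).+2%:R / (n + k0).+2%:R =
        1 + (k%:R - k0%:R) / (n + k0).+2%:R :> R.
      have E l : (n + l).+2%:R = n%:R + l%:R + 2 :> R by rewrite -[(_ + l).+2]addn2 !natrD.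
      by have := kp k0; rewrite !E => H0; field; rewrite gt_eqF.
    apply: le_ln1Dx; apply: (@lt_le_trans _ _ 0) => //.
    by rewrite divr_ge0 ?subr_ge0// ltW.
  move=> /(ler_wpM2l (ltW K0)); rewrite mulrDr => LL.
  suff : K * ((k%:R - k0%:R) / (n + k0).+2%:R) <= D / 2 * (k%:R - k0%:R).
    by move: LL; rewrite /m /e; set f := K * (_ / _); lra.
  rewrite mulrCA mulrC ler_wpM2r ?subr_ge0// ler_pdivrMr//.
  have : D * n%:R <= D * (n + k0).+2%:R.
    by rewrite ler_pM2l// ler_nat -addnS -addnS leq_addr.
  by move: nK; set N := (n + k0).+2%:R; lra.
move=> j ji Sj; have {}ji : (j <= j0)%N.
  by have /orP[//|] := gap j Sj; rewrite leqNgt (leq_trans ji ik0).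
have jk : (j <= k0)%N by exact: leq_trans jk0.
have := chord_estimate jk; rewrite ler_norml => /andP[_ H].
have jj0 : j%:R <= j0%:R :> R by rewrite ler_nat.
have jkR : 0 <= k0%:R - j%:R :> R by rewrite subr_ge0 ler_nat.
have : (k0%:R - j%:R) * (D / 2 * (k0%:R + j%:R + 1)) <= (k0%:R - j%:R) * m.
  rewrite ler_wpM2l// /m ler_pM2l ?divr_gt0//; lra.
by rewrite /e; lra.
Qed.

End GapSlope.

Lemma ghost_mult_eq0 (d dnew : int -> int) (i : nat) (m : int) :
  (ghost_mult d dnew i m == 0%N) = ~~ ((d m < i%:Z) && (i%:Z < d m + dnew m)).
Proof. by rewrite /ghost_mult; case: ifPn => //; case: ifPn; lia. Qed.

(** Apply ln(1 + x) <= x at x = y^(1/2) - 1, and ln y = 2 ln(y^(1/2)). *)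
Lemma ln_le_sqrt (R : realType) (y : R) : 0 < y -> ln y <= 2 * y `^ (1 / 2).
Proof.
move=> y0; have := @le_ln1Dx R (y `^ (1 / 2) - 1).
rewrite ltrBrDr addrC subrr powR_gt0// => /(_ isT).
by rewrite [1 + _]addrC subrK ln_powR; lra.
Qed.

Lemma abse_sub_shift (R : realType) (s : \bar R) (x y r q : R) :
  (`|s - x%:E| <= r%:E)%E -> `|x - y| <= q -> (`|s - y%:E| <= (r + q)%:E)%E.
Proof.
case: s => // s; rewrite -!EFinB !lee_fin => sx xy.
by apply: le_trans (lerD sx xy); exact: ler_distD.
Qed.

(** * Slopes in the three ranges of i *)

Theorem theorem3p1 (R : realType) (C : closedFieldType) (v : C -> \bar R)
    (p : nat) (hp : prime p) (hC : is_Cp v p)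
    (k0 : nat) (hk0 : (k0 < delta p)%N)
    (gamma : C) (hgamma : top_generator v p gamma)
    (d dnew : int -> int) (A B : R)
    (hG : hypG d dnew) (hND : hypND d dnew) (hLG : hypLG d dnew A B) :
  let D : R := (qq p)%:R / (p%:R - 1) *
               (B ^+ 2 / (A * (A + B) * (2 * A + B))) in
  let k (n : int) : int := kn p k0 n in
  let s (n : int) (i : nat) : \bar R :=
    NP_slope v (ghost_series p k0 gamma d dnew (int_weight (k n))) i in
  [/\ exists2 c : R, 0 < c & exists N : int, forall n : int, N <= n ->
        forall i : nat, (1 <= i)%N -> i%:Z <= d n ->
        (`|s n i - (D * i%:R)%:E| <= (c * ln n%:~R)%:E)%E,
      exists2 c : R, 0 < c & exists N : int, forall n : int, N <= n ->
        forall i : nat, d n < i%:Z -> i%:Z <= d n + dnew n ->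
        (`|s n i - (p%:R / (p%:R - 1) ^+ 2 * (B ^+ 2 / (2 * A * (A + B)))
                    * (k n)%:~R)%:E| <= (c * ln n%:~R)%:E)%E &
      forall eps : R, 0 < eps ->
      exists2 c : R, 0 < c & exists N : int, forall n : int, N <= n ->
        forall i : nat, d n + dnew n < i%:Z ->
        (`|s n i - (D * i%:R)%:E| <= (c * i%:R `^ (1 / 2 + eps))%:E)%E].
Proof.
move=> D k s.
have [A0 B0 _ _] := hLG.
have AB0 : 0 < A + B by rewrite addr_gt0.
have AB20 : 0 < 2 * A + B by rewrite addr_gt0// mulr_gt0.
have c0 : 0 < (qq p)%:R / (p%:R - 1) :> R by exact: c1_gt0.
have D0 : 0 < D by rewrite mulr_gt0// divr_gt0 ?exprn_gt0// !mulr_gt0.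
have l2 : 0 < ln 2 :> R by rewrite ln_gt0// ltr1n.
have [h [K K0 [vh h0 hS]]] := ghost_heights hC hp k0 hgamma hG hND hLG.
have [Kd Kd0 dK'] := asymp_linear_nat 0 (asymp_linear_comb hLG 1 0).
have [Ke Ke0 eK'] := asymp_linear_nat 0 (asymp_linear_comb hLG 1 1).
have dK (n : nat) : - Kd <= (d n)%:~R - A * n%:R <= Kd.
  by have := dK' n; rewrite subr0 ler_norml !(mul1r, mul0r, addr0).
have eK (n : nat) : - Ke <= (d n + dnew n)%:~R - (A + B) * n%:R <= Ke.
  by have := eK' n; rewrite subr0 ler_norml !(mul1r, mul0r, addr0).
clear dK' eK'.
(* For n >= X, 2K <= Dn holds and d n, d n + dnew n are nonnegative; the 3 in [N0] ensures n >= 2,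
   so that ln n >= ln 2. *)
pose X := 2 * K / D + Kd / A + Ke / (A + B).
pose N0 := (Num.truncn X).+3.
have large (n : int) : N0%:Z <= n -> exists2 m : nat, n = m%:Z &
    [/\ (2 <= m)%N, 2 * K <= D * m%:R, 0 <= d m & 0 <= d m + dnew m].
  case: n => [m|//] N0m; exists m => //.
  have {}N0m : (N0 <= m)%N by [].
  have Xm : X <= m%:R.
    apply: (le_trans (ltW (truncnS_gt X))); rewrite ler_nat.
    by apply: leq_trans N0m; rewrite /N0 ltnW.
  have x1 : 0 <= 2 * K / D by rewrite !mulr_ge0 ?invr_ge0 ?(ltW D0) ?(ltW K0).
  have x2 : 0 <= Kd / A by rewrite divr_ge0// ltW.
  have x3 : 0 <= Ke / (A + B) by rewrite divr_ge0// ltW.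
  have [X1 X2 X3] : [/\ 2 * K / D <= m%:R, Kd / A <= m%:R & Ke / (A + B) <= m%:R].
    move: Xm x1 x2 x3; rewrite /X; clear.
    by set a := 2 * K / D; set b := Kd / A; set c := Ke / _ => *; split; lra.
  split.
  - by apply: leq_trans N0m; rewrite /N0.
  - by rewrite [leRHS]mulrC -ler_pdivrMr.
  - have : Kd <= A * m%:R by rewrite mulrC -ler_pdivrMr.
    by rewrite -(ler0z R); have := dK m; lra.
  - have : Ke <= (A + B) * m%:R by rewrite mulrC -ler_pdivrMr.
    by rewrite -(ler0z R); have := eK m; lra.
pose S (n : nat) : pred nat := fun j => ghost_mult d dnew j n == 0%N.
have SE (n j : nat) : S n j = ~~ ((d n < j%:Z) && (j%:Z < d n + dnew n)).
  exact: ghost_mult_eq0.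
have slope (n : nat) (i j0 i0 : nat) : 2 * K <= D * n%:R ->
    (1 <= i)%N -> (j0 < i)%N -> (i <= i0)%N -> S n j0 -> S n i0 ->
    (forall j, S n j -> (j <= j0)%N || (i0 <= j)%N) ->
    (`|s n i - (D / 2 * (i0%:R + j0%:R + 1))%:E| <=
     (K * ln (n + i0).+2%:R)%:E)%E.
  move=> nK i1 j0i ii0 Sj Si gap.
  exact: (slope_on_gap (vh n) (fun j _ => h0 n j) (hS n) D0 K0 nK i1 j0i ii0 Sj Si gap).
(* The gap is (i - 1, i), where D/2 (i + (i - 1) + 1) = D i. *)
have slope1 (n : nat) (i : nat) : 2 * K <= D * n%:R -> (1 <= i)%N ->
    S n i.-1 -> S n i ->
    (`|s n i - (D * i%:R)%:E| <= (K * ln (n + i).+2%:R)%:E)%E.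
  case: i => // i nK _ Si Si1.
  have -> : D * i.+1%:R = D / 2 * (i.+1%:R + i%:R + 1).
    by rewrite -natr1; field.
  by apply: slope => // j _; case: leqP.
split.
(* Part (a): i - 1 and i are at most d n, and i <= An + Kd makes the error O(ln n). *)
- have cge0 : 0 <= A + Kd + 2 by rewrite !addr_ge0// ltW.
  have [c c_gt0 hc] := ln_affine_bound cge0.
  exists (K * c); first by rewrite mulr_gt0.
  exists N0%:Z => _ /large[n -> [n2 nK _ _]] i i1 id.
  apply: le_trans (slope1 n i nK i1 _ _) _.
  + by rewrite SE negb_and -leNgt (le_trans _ id)// lez_nat leq_pred.
  + by rewrite SE negb_and -leNgt id.
  rewrite lee_fin -mulrA ler_pM2l// -pmulrn; apply: hc => //.
  have nR : 2 <= n%:R :> R by rewrite (ler_nat _ 2).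
  have /andP[_ dn] := dK n.
  have iR : i%:R <= (d n)%:~R :> R by rewrite pmulrn ler_int.
  have KdnR : Kd <= Kd * n%:R by rewrite ler_peMr//; lra.
  by rewrite -natr1 -[_.+1%:R]natr1 natrD; lra.
(* Part (b): the gap runs from d n to d n + dnew n, where the multiplicity is 0. Its ideal slope is
   D/2 (2A + B) n + O(1), and D/2 (2A + B) = P delta G. *)
- pose G := B ^+ 2 / (2 * A * (A + B)).
  pose P : R := p%:R / (p%:R - 1) ^+ 2.
  have p1 : 0 < p%:R - 1 :> R by rewrite subr_gt0 ltr1n prime_gt1.
  have P0 : 0 <= P * (G * k0%:R).
    have P_ge0 : 0 <= P by rewrite divr_ge0// exprn_ge0// ltW.
    have G_ge0 : 0 <= G.
      by rewrite divr_ge0 ?exprn_ge0 ?(ltW B0)// !mulr_ge0 ?(ltW A0) ?(ltW AB0).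
    by rewrite mulr_ge0// mulr_ge0.
  have Pdelta : P * (delta p)%:R = (qq p)%:R / (p%:R - 1).
    rewrite /P /delta /qq; case: eqVneq => [->|p2].
      have -> : 2%:R - 1 = 1 :> R by rewrite -[2%:R]natr1 addrK.
      by rewrite expr1n !divr1 -natrM.
    have -> : p.-1%:R = p%:R - 1 :> R.
      by rewrite -[in RHS](prednK (prime_gt0 hp)) -natr1 addrK.
    by field; rewrite gt_eqF.
  (* Bounds that O(1) together with the contribution of k0 to k_n. *)
  pose Q := D / 2 * (Kd + Ke + 1) + P * (G * k0%:R).
  have Q0 : 0 <= Q by rewrite addr_ge0// mulr_ge0 ?divr_ge0 ?(ltW D0)// !addr_ge0.
  have cge0 : 0 <= A + B + Ke + 2 by rewrite !addr_ge0// ltW.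
  have [c c_gt0 hc] := ln_affine_bound cge0.
  exists (K * c + Q / ln 2); first by rewrite ltr_wpDr ?mulr_gt0// divr_ge0// ltW.
  exists N0%:Z => _ /large[n -> [n2 nK d0 e0]] i di ie.
  have nR : 2 <= n%:R :> R by rewrite (ler_nat _ 2).
  have dE : (absz (d n))%:Z = d n by rewrite gez0_abs.
  have eE : (absz (d n + dnew n))%:Z = d n + dnew n by rewrite gez0_abs.
  have Hs := slope n i (absz (d n)) (absz (d n + dnew n)) nK.
  have {}Hs : (`|s n i - (D / 2 * ((d n + dnew n)%:~R + (d n)%:~R + 1))%:E| <=
     (K * ln (n + absz (d n + dnew n)).+2%:R)%:E)%E.
    rewrite -{1}eE -{2}dE -!pmulrn; apply: Hs.
    + by rewrite -ltz_nat; exact: le_lt_trans d0 di.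
    + by rewrite -ltz_nat dE.
    + by rewrite -lez_nat eE.
    + by rewrite SE dE ltxx.
    + by rewrite SE eE ltxx andbF.
    + by move=> j; rewrite SE negb_and -!leNgt -!lez_nat dE eE.
  have lnn : ln 2 <= ln n%:R :> R by apply: (@ler_ln_nat R 2).
  have Hln : K * ln (n + absz (d n + dnew n)).+2%:R <= K * c * ln n%:R.
    rewrite -mulrA ler_pM2l//; apply: hc => //.
    have /andP[_ en] := eK n.
    have KenR : Ke <= Ke * n%:R by rewrite ler_peMr//; lra.
    rewrite -natr1 -[_.+1%:R]natr1 natrD [(absz _)%:R]pmulrn eE; lra.
  apply: le_trans (abse_sub_shift (q := Q) Hs _) _.
    have -> : P * G * (k n)%:~R = D / 2 * (2 * A + B) * n%:R + P * (G * k0%:R).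
      rewrite /k /kn rmorphD rmorphM /= -!pmulrn.
      have -> : D / 2 * (2 * A + B) = P * (delta p)%:R * G.
        by rewrite Pdelta /D /G; field; rewrite !gt_eqF.
      ring.
    have := dK n; have := eK n.
    set x := (d n)%:~R; set y := (d n + dnew n)%:~R.
    move=> /andP[e1 e2] /andP[d1 d2].
    have H1 : D / 2 * (y + x + 1 - (2 * A + B) * n%:R) <= D / 2 * (Kd + Ke + 1).
      by rewrite ler_pM2l ?divr_gt0//; lra.
    have H2 : D / 2 * - (Kd + Ke + 1) <= D / 2 * (y + x + 1 - (2 * A + B) * n%:R).
      by rewrite ler_pM2l ?divr_gt0//; lra.
    by rewrite ler_norml /Q; apply/andP; split; lra.
  rewrite lee_fin -pmulrn mulrDl lerD// mulrAC ler_pdivlMr//.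
  by rewrite ler_wpM2l.
- move=> eps eps0.
  (* Part (c): (A + B) n <= d n + dnew n + Ke < i + Ke gives n = O(i), and [c] is such that n + i +
     2 <= c i. *)
  pose c := (1 + Ke) / (A + B) + 3.
  have c_gt0 : 0 < c by rewrite ltr_wpDl// divr_ge0 ?(ltW AB0)// addr_ge0.
  exists (K * (2 * c `^ (1 / 2))); first by rewrite mulr_gt0// mulr_gt0// powR_gt0.
  exists N0%:Z => _ /large[n -> [n2 nK _ e0]] i ei.
  have i1 : (1 <= i)%N by rewrite -ltz_nat; exact: le_lt_trans e0 ei.
  apply: le_trans (slope1 n i nK i1 _ _) _.
  + rewrite SE negb_and -!leNgt (_ : d n + dnew n <= _) ?orbT//.
    by clear -ei i1; lia.
  + by rewrite SE negb_and -!leNgt (ltW ei) orbT.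
  have iR : 1 <= i%:R :> R by rewrite ler1n.
  rewrite lee_fin -mulrA ler_pM2l//.
  apply: le_trans (ln_le_sqrt _) _; first by rewrite ltr0n.
  rewrite -mulrA ler_pM2l//.
  apply: le_trans (_ : (c * i%:R) `^ (1 / 2) <= _).
    rewrite ge0_ler_powR ?nnegrE//; first by rewrite mulr_ge0// ltW.
    have /andP[en _] := eK n.
    have eiR : (d n + dnew n)%:~R <= i%:R :> R by rewrite pmulrn ler_int ltW.
    have : n%:R <= (i%:R + Ke) / (A + B) by rewrite ler_pdivlMr//; lra.
    have : (i%:R + Ke) / (A + B) <= (1 + Ke) / (A + B) * i%:R.
      rewrite mulrAC ler_pM2r ?invr_gt0// mulrDl mul1r lerD2l.
      by rewrite ler_peMr.
    by rewrite /c -natr1 -[_.+1%:R]natr1 natrD; lra.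
  rewrite powRM ?(ltW c_gt0)//; apply: ler_wpM2l; first exact: powR_ge0.
  by apply: ler_powR => //; rewrite lerDl ltW.
Qed.
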